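(* Let $R$ be a commutative Noetherian ring with non-zero identity, $\mathfrak a$ an ideal of $R$, $M$ a finitely generated $R$-module, $X$ an arbitrary $R$-module and $n$ a non-negative integer. Then: (a) $\displaystyle\prod_{i=0}^{n}\big(0:_R\operatorname{Ext}^{n-i}_R(M,H^i_{\mathfrak a}(X))\big)\subseteq\big(0:_RH^n_{\mathfrak a}(M,X)\big)$. (b) $\displaystyle\prod_{i=0}^{n}\big(0:_RH^i_{\mathfrak a}(X)\big)\subseteq\bigcap_{i=0}^{n}\big(0:_RH^i_{\mathfrak a}(M,X)\big)$.
   Context: $H^i_{\mathfrak a}(M,X)=\varinjlim_{k}\operatorname{Ext}^i_R(M/\mathfrak a^kM,X)$ is the $i$-th generalized local cohomology module, and $H^i_{\mathfrak a}(X)=H^i_{\mathfrak a}(R,X)$ is ordinary local cohomology. $(0:_RY)$ denotes the annihilator of the $R$-module $Y$; products are products of ideals. *)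

(* Defs.v *)
From HB Require Import structures.
From mathcomp Require Import all_boot all_order all_algebra.
From mathcomp Require Import generic_quotient ring_quotient finmap.
From mathcomp Require Import boolp classical_sets functions.
From mathcomp.multinomials Require Import monalg.

Set Implicit Arguments.
Unset Strict Implicit.
Unset Printing Implicit Defensive.

Import GRing.Theory.
Local Open Scope classical_set_scope.
Local Open Scope ring_scope.
Local Open Scope quotient_scope.

Section Submodules.
Context (R : comNzRingType).

Definition is_submod (V : lmodType R) (N : set V) : Prop :=
  N 0 /\ forall (c : R) (u v : V), N u -> N v -> N (c *: u + v).

Record submod (V : lmodType R) := Submod {
  submod_pred :> V -> Prop;
  submodP : is_submod submod_pred }.

(* A submodule as a boolean predicate, so that the closure structures, subtypes
   and quotients of the algebra library apply to it. *)
Definition submod_mem (V : lmodType R) (N : submod V) : V -> bool :=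
  fun v => `[< N v >].

Lemma submod_memP (V : lmodType R) (N : submod V) (v : V) :
  reflect (N v) (v \in submod_mem N).
Proof. exact: asboolP. Qed.

Lemma submod_mem_closed (V : lmodType R) (N : submod V) :
  submod_closed (submod_mem N).
Proof.
have [N0 NZ] := submodP N; split; first exact/submod_memP.
by move=> c u v /submod_memP Nu /submod_memP Nv; exact/submod_memP/NZ.
Qed.

Lemma submod_mem_subclosed (V : lmodType R) (N : submod V) :
  subsemimod_closed (submod_mem N).
Proof.
split; first split.
- exact: (submod_mem_closed N).1.
- by move=> u v Nu Nv; rewrite -[u]scale1r; apply: (submod_mem_closed N).2.
- move=> c u Nu; rewrite -[_ *: _]addr0.
  by apply: (submod_mem_closed N).2 => //; exact: (submod_mem_closed N).1.
Qed.

HB.instance Definition _ (V : lmodType R) (N : submod V) :=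
  GRing.isSubmodClosed.Build R V (submod_mem N) (submod_mem_subclosed N).

Definition subm (V : lmodType R) (N : submod V) : Type :=
  {v : V | submod_mem N v}.

HB.instance Definition _ (V : lmodType R) (N : submod V) :=
  [isSub of subm N for @sval V (submod_mem N)].
HB.instance Definition _ (V : lmodType R) (N : submod V) :=
  [Choice of subm N by <:].
HB.instance Definition _ (V : lmodType R) (N : submod V) :=
  [SubChoice_isSubLmodule of subm N by <:].

Definition submk (V : lmodType R) (N : submod V) (v : V) (Nv : N v) : subm N :=
  exist _ v (asboolT Nv).

Lemma subm_valP (V : lmodType R) (N : submod V) (x : subm N) : N (val x).
Proof. by apply/asboolP; case: x. Qed.

Lemma subm_val_linear (V : lmodType R) (N : submod V) :
  linear (fun x : subm N => val x).
Proof. by []. Qed.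

Definition subm_val (V : lmodType R) (N : submod V) : {linear subm N -> V} :=
  HB.pack (fun x : subm N => val x)
    (GRing.isLinear.Build R (subm N) V _ _ (@subm_val_linear V N)).

Section SubmMap.
Context (V W : lmodType R) (N : submod V) (P : submod W).
Context (f : {linear V -> W}) (fNP : forall v, N v -> P (f v)).

Definition subm_map_fun (x : subm N) : subm P := submk (fNP (subm_valP x)).

Lemma subm_map_linear : linear subm_map_fun.
Proof. by move=> c x y; apply: val_inj; rewrite /= linearP. Qed.

Definition subm_map : {linear subm N -> subm P} :=
  HB.pack subm_map_fun
    (GRing.isLinear.Build R (subm N) (subm P) _ _ subm_map_linear).
End SubmMap.

Definition submod_zmod (V : lmodType R) (N : submod V) : zmodClosed V :=
  GRing.ZmodClosed.clone V (submod_mem N) _.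

Definition quom (V : lmodType R) (N : submod V) : Type :=
  Quotient.quot (submod_zmod N).

HB.instance Definition _ (V : lmodType R) (N : submod V) :=
  GRing.Zmodule.on (quom N).

Section QuomTheory.
Context (V : lmodType R) (N : submod V).

Definition quom_pi (v : V) : quom N := \pi_(Quotient.quot (submod_zmod N)) v.
Definition quom_repr (x : quom N) : V := repr x.

Lemma quom_reprK : cancel quom_repr quom_pi.
Proof. exact: reprK. Qed.

Lemma quom_eqP (u v : V) : quom_pi u = quom_pi v <-> N (u - v).
Proof.
split=> [/eqP|]; first by rewrite -Quotient.idealrBE => /submod_memP.
by move=> Nuv; apply/eqP; rewrite -Quotient.idealrBE; apply/submod_memP.
Qed.

Lemma quom_piD (u v : V) : quom_pi (u + v) = quom_pi u + quom_pi v.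
Proof. exact: Quotient.pi_add. Qed.

Definition quom_scale (c : R) (x : quom N) : quom N :=
  quom_pi (c *: quom_repr x).

Lemma quom_piZ (c : R) (v : V) : quom_scale c (quom_pi v) = quom_pi (c *: v).
Proof.
apply/quom_eqP; rewrite -scalerBr.
have := (quom_eqP _ v).1 (quom_reprK (quom_pi v)).
by move=> /submod_memP H; apply/submod_memP; rewrite rpredZ.
Qed.

Lemma quom_scaleA c d x : quom_scale c (quom_scale d x) = quom_scale (c * d) x.
Proof. by rewrite -[x]quom_reprK !quom_piZ scalerA. Qed.
Lemma quom_scale1 : left_id 1 quom_scale.
Proof. by move=> x; rewrite -[x]quom_reprK quom_piZ scale1r. Qed.
Lemma quom_scaleDr : right_distributive quom_scale +%R.
Proof.
move=> c x y; rewrite -[x]quom_reprK -[y]quom_reprK.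
by rewrite -quom_piD !quom_piZ -quom_piD scalerDr.
Qed.
Lemma quom_scaleDl x : {morph quom_scale^~ x : c d / c + d}.
Proof.
by move=> c d /=; rewrite -[x]quom_reprK !quom_piZ -quom_piD scalerDl.
Qed.

HB.instance Definition _ := GRing.Zmodule_isLmodule.Build R (quom N)
  quom_scaleA quom_scale1 quom_scaleDr quom_scaleDl.

Lemma quom_pi_linear : linear quom_pi.
Proof. by move=> c u v; rewrite quom_piD -quom_piZ. Qed.
HB.instance Definition _ :=
  GRing.isLinear.Build R V (quom N) _ quom_pi quom_pi_linear.
End QuomTheory.

Section QuomMap.
Context (V W : lmodType R) (N : submod V) (P : submod W).
Context (f : {linear V -> W}) (fNP : forall v, N v -> P (f v)).

Definition quom_map_fun (x : quom N) : quom P := quom_pi P (f (quom_repr x)).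

Lemma quom_map_pi (v : V) : quom_map_fun (quom_pi N v) = quom_pi P (f v).
Proof.
apply/quom_eqP; rewrite -linearB; apply: fNP.
exact: (quom_eqP N _ v).1 (quom_reprK _).
Qed.

Lemma quom_map_linear : linear quom_map_fun.
Proof.
move=> c x y; rewrite -[x]quom_reprK -[y]quom_reprK -linearP.
by rewrite !quom_map_pi linearP linearP.
Qed.

Definition quom_map : {linear quom N -> quom P} :=
  HB.pack quom_map_fun
    (GRing.isLinear.Build R (quom N) (quom P) _ _ quom_map_linear).
End QuomMap.

(* The subquotient Z / (B :&: Z); it is only used with B contained in Z. *)
Section Subquotient.
Context (V : lmodType R) (Z B : submod V).

Lemma subquot_is_submod : is_submod [set x : subm Z | B (val x)].
Proof.
have [B0 BZ] := submodP B; split=> [//|c u v Bu Bv] /=.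
exact: BZ.
Qed.

Definition subquot : lmodType R := quom (Submod subquot_is_submod).
End Subquotient.

Section SubquotientMap.
Context (V W : lmodType R) (Z B : submod V) (Z' B' : submod W).
Context (f : {linear V -> W}).
Context (fZ : forall v, Z v -> Z' (f v)) (fB : forall v, B v -> B' (f v)).

Definition subquot_map : {linear subquot Z B -> subquot Z' B'} :=
  quom_map (N := Submod (subquot_is_submod Z B))
    (P := Submod (subquot_is_submod Z' B'))
    (f := subm_map fZ) (fun x Bx => fB Bx).
End SubquotientMap.

End Submodules.

Section IdealsAndFiniteness.
Context (R : comNzRingType).

Definition is_ideal (I : set R) : Prop := is_submod (I : set R^o).

(* For an ideal I and a submodule N this is the submodule I N. *)
Definition set_scale (V : lmodType R) (I : set R) (N : set V) : set V :=
  [set v | exists (m : nat) (r : 'I_m -> R) (u : 'I_m -> V),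
     [/\ forall i, I (r i), forall i, N (u i) & v = \sum_(i < m) r i *: u i]].

Definition ideal_mul (I J : set R) : set R := set_scale I (J : set R^o).

Definition ideal_exp (I : set R) (k : nat) : set R :=
  iter k (ideal_mul I) [set: R].

Definition annihilator (V : lmodType R) : set R :=
  [set r | forall v : V, r *: v = 0].

Definition fin_gen (V : lmodType R) (N : set V) : Prop :=
  exists (m : nat) (g : 'I_m -> V),
    N = [set v | exists c : 'I_m -> R, v = \sum_(i < m) c i *: g i].

Definition noetherian : Prop :=
  forall I : set R, is_ideal I -> fin_gen (I : set R^o).

Lemma set_scale_submod (V : lmodType R) (I : set R) (N : set V) :
  is_submod N -> is_submod (set_scale I N).
Proof.
move=> [N0 NZ]; split.
  by exists 0, (fun=> 0), (fun=> 0); split=> [[]//|[]//|]; rewrite big_ord0.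
move=> c _ _ [m [r [u [Ir Nu ->]]]] [m' [r' [u' [Ir' Nu' ->]]]].
exists (m + m')%N.
exists (fun i : 'I_(m + m') => match fintype.split i with inl j => r j | inr j => r' j end).
exists (fun i : 'I_(m + m') => match fintype.split i with inl j => c *: u j | inr j => u' j end).
split=> [i|i|].
- by case: splitP.
- by case: splitP => // j _; rewrite -[_ *: _]addr0; apply: NZ.
rewrite big_split_ord /= scaler_sumr; congr (_ + _); apply: eq_bigr => i _.
  by rewrite (unsplitK (inl i)) !scalerA mulrC.
by rewrite (unsplitK (inr i)).
Qed.

Lemma setT_submod (V : lmodType R) : is_submod [set: V].
Proof. by []. Qed.

Lemma ideal_exp_ideal (I : set R) (k : nat) : is_ideal (ideal_exp I k).
Proof.
elim: k => [|k IH]; first exact: (@setT_submod R^o).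
exact: (@set_scale_submod R^o).
Qed.

Lemma ideal_expS (I : set R) (k : nat) : ideal_exp I k.+1 `<=` ideal_exp I k.
Proof.
have [I0 IZ] := ideal_exp_ideal I k.
move=> _ [m [r [u [Ir Iu ->]]]]; elim/big_ind: _ => //.
- by move=> x y Ix Iy; have := IZ 1 x y Ix Iy; rewrite scale1r.
- by move=> i _; have := IZ (r i) (u i) 0 (Iu i) I0; rewrite addr0.
Qed.

End IdealsAndFiniteness.

(* The direct limit of E 0 -> E 1 -> ..., as the direct sum of the E k modulo
   the submodule of all sums of elements x - t k x (x in E k), that is, of all
   w - shift w for w in the direct sum. *)
Section DirectLimit.
Context (R : comNzRingType).

Definition dprod (E : nat -> lmodType R) : Type := forall k, E k.

HB.instance Definition _ (E : nat -> lmodType R) :=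
  gen_eqMixin (dprod E).
HB.instance Definition _ (E : nat -> lmodType R) :=
  gen_choiceMixin (dprod E).

Section DprodLmod.
Context (E : nat -> lmodType R).
Implicit Types s t : dprod E.

Definition dprod_zero : dprod E := fun k => 0.
Definition dprod_opp s : dprod E := fun k => - s k.
Definition dprod_add s t : dprod E := fun k => s k + t k.
Definition dprod_scale (c : R) s : dprod E := fun k => c *: s k.

Lemma dprod_addA : associative dprod_add.
Proof. by move=> *; apply: functional_extensionality_dep => k; apply: addrA. Qed.
Lemma dprod_addC : commutative dprod_add.
Proof. by move=> *; apply: functional_extensionality_dep => k; apply: addrC. Qed.
Lemma dprod_add0 : left_id dprod_zero dprod_add.
Proof. by move=> *; apply: functional_extensionality_dep => k; apply: add0r. Qed.
Lemma dprod_addN : left_inverse dprod_zero dprod_opp dprod_add.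
Proof. by move=> *; apply: functional_extensionality_dep => k; apply: addNr. Qed.

HB.instance Definition _ := GRing.isZmodule.Build (dprod E)
  dprod_addA dprod_addC dprod_add0 dprod_addN.

Lemma dprod_scaleA c d s :
  dprod_scale c (dprod_scale d s) = dprod_scale (c * d) s.
Proof. by apply: functional_extensionality_dep => k; apply: scalerA. Qed.
Lemma dprod_scale1 : left_id 1 dprod_scale.
Proof. by move=> s; apply: functional_extensionality_dep => k; apply: scale1r. Qed.
Lemma dprod_scaleDr : right_distributive dprod_scale +%R.
Proof. by move=> *; apply: functional_extensionality_dep => k; apply: scalerDr. Qed.
Lemma dprod_scaleDl s : {morph dprod_scale^~ s : c d / c + d}.
Proof. by move=> *; apply: functional_extensionality_dep => k; apply: scalerDl. Qed.

HB.instance Definition _ := GRing.Zmodule_isLmodule.Build R (dprod E)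
  dprod_scaleA dprod_scale1 dprod_scaleDr dprod_scaleDl.
End DprodLmod.

Context (E : nat -> lmodType R) (t : forall k, {linear E k -> E k.+1}).

Definition finite_supp : set (dprod E) :=
  [set s | exists K, forall k, (K <= k)%N -> s k = 0].

Definition shift (s : dprod E) : dprod E :=
  fun k => match k with 0 => 0 | j.+1 => t j (s j) end.

Lemma shift_linear : linear shift.
Proof.
move=> c u v; apply: functional_extensionality_dep => -[|k].
  by change (0 = c *: (0 : E 0) + 0); rewrite scaler0 addr0.
exact: (linearP (t k)).
Qed.

Definition limit_rel : set (dprod E) :=
  [set w - shift w | w in finite_supp].

Lemma finite_supp_submod : is_submod finite_supp.
Proof.
split; first by exists 0%N.
move=> c u v [K uK] [L vL]; exists (maxn K L) => k.
rewrite geq_max => /andP[Kk Lk].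
change (c *: u k + v k = 0).
by rewrite uK // vL // scaler0 addr0.
Qed.

Lemma limit_rel_submod : is_submod limit_rel.
Proof.
have [D0 DZ] := finite_supp_submod; split.
  exists 0 => //; have := shift_linear (-1) 0 0.
  by rewrite !scaleN1r !addNr => ->; rewrite subr0.
move=> c _ _ [u Du <-] [v Dv <-]; exists (c *: u + v); first exact: DZ.
by rewrite shift_linear opprD addrACA scalerBr.
Qed.

Lemma limit_rel_finite_supp w : limit_rel w -> finite_supp w.
Proof.
move=> [u [K uK] <-]; exists K.+1 => -[//|k] Kk.
change (u k.+1 - t k (u k) = 0).
have -> : u k.+1 = 0 by apply: uK; exact: ltnW.
by rewrite (uK k Kk) linear0 subr0.
Qed.

Definition direct_limit : lmodType R :=
  subquot (Submod finite_supp_submod) (Submod limit_rel_submod).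
End DirectLimit.

Section FreeResolution.
Context (R : comNzRingType).

Section FreeLift.
Context (S : choiceType) (V : lmodType R) (h : S -> V).

Definition free_lift_fun (g : {malg R[S]}) : V :=
  \sum_(x <- msupp g) g@_x *: h x.

Lemma free_lift_funE (g : {malg R[S]}) (D : {fset S}) :
  (msupp g `<=` D)%fset -> free_lift_fun g = \sum_(x <- D) g@_x *: h x.
Proof.
move=> gD; rewrite /free_lift_fun (big_fset_incl _ gD) //= => x _.
by rewrite -mcoeff_eq0 => /eqP ->; rewrite scale0r.
Qed.

Lemma free_lift_linear : linear free_lift_fun.
Proof.
move=> c u v; pose D := (msupp u `|` msupp v)%fset.
have uD : (msupp u `<=` D)%fset by exact: fsubsetUl.
have vD : (msupp v `<=` D)%fset by exact: fsubsetUr.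
have wD : (msupp (c *: u + v) `<=` D)%fset.
  by rewrite (fsubset_trans (msuppD_le _ _))// fsetUSS// msuppZ_le.
rewrite !(free_lift_funE (D := D))// scaler_sumr -big_split /=.
by apply: eq_bigr => x _; rewrite mcoeffD mcoeffZ scalerDl scalerA.
Qed.

Definition free_lift : {linear {malg R[S]} -> V} :=
  HB.pack free_lift_fun
    (GRing.isLinear.Build R {malg R[S]} V _ _ free_lift_linear).

Lemma free_liftU (x : S) : free_lift << x >> = h x.
Proof.
rewrite /= (free_lift_funE (D := [fset x]%fset)) ?msuppU_le //.
by rewrite big_seq_fset1 mcoeffUU scale1r.
Qed.
End FreeLift.

Definition aug (V : lmodType R) : {linear {malg R[V]} -> V} :=
  free_lift (fun x : V => x).

Lemma ker_submod (V W : lmodType R) (f : {linear V -> W}) :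
  is_submod [set v | f v = 0].
Proof.
split=> [|c u v /= fu fv]; first exact: linear0.
by rewrite linearP fu fv scaler0 addr0.
Qed.

Definition kernel (V W : lmodType R) (f : {linear V -> W}) : submod V :=
  Submod (ker_submod f).

Definition free_map (V W : lmodType R) (f : V -> W) :
  {linear {malg R[V]} -> {malg R[W]}} :=
  free_lift (fun x : V => << f x >> : {malg R[W]}).

Lemma malg_linear_ext (S : choiceType) (V : lmodType R)
    (f g : {linear {malg R[S]} -> V}) : (forall x, f << x >> = g << x >>) -> f =1 g.
Proof.
move=> fg u; rewrite [u]monalgE !linear_sum; apply: eq_bigr => x _ /=.
have -> : << u@_x *g x >> = u@_x *: << x >> :> {malg R[S]}.
  apply/malgP => y; rewrite mcoeffZ !mcoeffU.
  by case: eqP => _; rewrite ?mulr1 ?mulr0.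
by rewrite !linearZ /= fg.
Qed.

Lemma aug_free_map (V W : lmodType R) (f : {linear V -> W}) u :
  aug W (free_map f u) = f (aug V u).
Proof.
move: u; apply: (@malg_linear_ext V W (aug W \o free_map f) (f \o aug V)) => x.
change (aug W (free_map f << x >>) = f (aug V << x >>)).
by rewrite /free_map /aug !free_liftU.
Qed.

(* syz n M is the n-th syzygy module of M in the canonical free resolution
   ... -> {malg R[syz 1 M]} -> {malg R[syz 0 M]} -> M -> 0,
   in which every syzygy is covered by the free module on its elements. *)
Fixpoint syz (n : nat) (M : lmodType R) : lmodType R :=
  match n with
  | 0 => M
  | n'.+1 => subm (kernel (aug (syz n' M)))
  end.

Definition free_res (n : nat) (M : lmodType R) : lmodType R :=
  {malg R[syz n M]}.

Definition free_diff (n : nat) (M : lmodType R) :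
    {linear free_res n.+1 M -> free_res n M} :=
  subm_val (kernel (aug (syz n M))) \o aug (syz n.+1 M).

Lemma kernelP (V W : lmodType R) (f : {linear V -> W}) (x : subm (kernel f)) :
  f (subm_val (kernel f) x) = 0.
Proof. exact: subm_valP x. Qed.

Lemma free_diffE (n : nat) (M : lmodType R) u :
  free_diff n M u = subm_val (kernel (aug (syz n M))) (aug (syz n.+1 M) u).
Proof. by []. Qed.

Lemma free_diffK (n : nat) (M : lmodType R) u :
  free_diff n M (free_diff n.+1 M u) = 0.
Proof. by rewrite free_diffE free_diffE kernelP linear0. Qed.

Lemma free_map_kernel (V W : lmodType R) (f : {linear V -> W}) u :
  kernel (aug V) u -> kernel (aug W) (free_map f u).
Proof.
move=> uK; change (aug W (free_map f u) = 0).
by rewrite aug_free_map (uK : aug V u = 0) linear0.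
Qed.

Fixpoint syz_map (n : nat) (M N : lmodType R) (f : {linear M -> N}) :
    {linear syz n M -> syz n N} :=
  match n return {linear syz n M -> syz n N} with
  | 0 => f
  | n'.+1 => subm_map (@free_map_kernel _ _ (syz_map n' f))
  end.

Definition free_res_map (n : nat) (M N : lmodType R) (f : {linear M -> N}) :
    {linear free_res n M -> free_res n N} := free_map (syz_map n f).

Lemma free_res_map_diff (n : nat) (M N : lmodType R) (f : {linear M -> N}) u :
  free_res_map n f (free_diff n M u) = free_diff n N (free_res_map n.+1 f u).
Proof.
change (free_map (syz_map n f) (val (aug (syz n.+1 M) u)) =
  val (aug (syz n.+1 N) (free_map (syz_map n.+1 f) u))).
by rewrite aug_free_map.
Qed.

End FreeResolution.

Section Ext.
Context (R : comNzRingType).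

Lemma linear_submod (U V : lmodType R) : is_submod [set f : U -> V | linear f].
Proof.
split=> [c u v|c f g fL gL d u v]; first by rewrite scaler0 addr0.
change (c *: f (d *: u + v) + g (d *: u + v) =
        d *: (c *: f u + g u) + (c *: f v + g v)).
rewrite fL gL !scalerDr !scalerA addrACA.
by rewrite [c * d]mulrC.
Qed.

Definition homR (U V : lmodType R) : lmodType R :=
  subm (Submod (linear_submod U V)).

Section Precomp.
Context (U U' V : lmodType R) (f : {linear U -> U'}).

Lemma precomp_subproof (u : U' -> V) : linear u -> linear (u \o f).
Proof. by move=> uL c x y /=; rewrite linearP uL. Qed.

Lemma precomp_fct_linear : linear (fun u : U' -> V => (u \o f : U -> V)).
Proof. by []. Qed.

Definition precomp_fct : {linear (U' -> V) -> (U -> V)} :=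
  HB.pack (fun u : U' -> V => (u \o f : U -> V))
    (GRing.isLinear.Build R (U' -> V) (U -> V) _ _ precomp_fct_linear).

Definition precomp : {linear homR U' V -> homR U V} :=
  subm_map (N := Submod (linear_submod U' V)) (P := Submod (linear_submod U V))
    (f := precomp_fct) precomp_subproof.

Lemma precompE (u : homR U' V) (x : U) : val (precomp u) x = val u (f x).
Proof. by []. Qed.

Lemma homR0 (u : homR U V) : val u 0 = 0.
Proof.
have /(_ (-1) 0 0) := subm_valP u.
by rewrite scaler0 addr0 scaleN1r addNr.
Qed.
End Precomp.

Definition cocycles (n : nat) (M X : lmodType R) :
    submod (homR (free_res n M) X) := kernel (precomp X (free_diff n M)).

Definition coboundary_set (n : nat) (M X : lmodType R) :
    set (homR (free_res n M) X) :=
  match n with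
  | 0 => [set 0]
  | m.+1 => range (precomp X (free_diff m M))
  end.

Lemma coboundary_submod n M X : is_submod (@coboundary_set n M X).
Proof.
case: n => [|m]; split.
- by [].
- by move=> c u v /= -> ->; rewrite scaler0 addr0.
- by exists 0 => //; rewrite linear0.
- move=> c _ _ [u _ <-] [v _ <-]; exists (c *: u + v) => //.
  by rewrite linearP.
Qed.

Definition coboundaries (n : nat) (M X : lmodType R) :
    submod (homR (free_res n M) X) := Submod (coboundary_submod n M X).

Lemma coboundaries_cocycles (n : nat) (M X : lmodType R) u :
  coboundaries n M X u -> cocycles n M X u.
Proof.
case: n u => [|n] u.
  by move=> u0; rewrite (u0 : u = 0); exact: linear0.
move=> [v _ <-]; apply: val_inj; apply/funext => x.
by rewrite !precompE free_diffK homR0.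
Qed.

(* Ext^n_R(M, X), the n-th cohomology module of Hom_R(free_res M, X). *)
Definition Ext (n : nat) (M X : lmodType R) : lmodType R :=
  subquot (cocycles n M X) (coboundaries n M X).

Section ExtMap.
Context (M N X : lmodType R) (f : {linear M -> N}).

Lemma precomp_comm n (u : homR (free_res n N) X) :
  precomp X (free_res_map n.+1 f) (precomp X (free_diff n N) u) =
  precomp X (free_diff n M) (precomp X (free_res_map n f) u).
Proof.
apply: val_inj; apply/funext => x.
change (val u (free_diff n N (free_res_map n.+1 f x)) =
        val u (free_res_map n f (free_diff n M x))).
by rewrite free_res_map_diff.
Qed.

Lemma Ext_map_cocycle n (u : homR (free_res n N) X) :
  cocycles n N X u -> cocycles n M X (precomp X (free_res_map n f) u).
Proof.
move=> uZ; change (precomp X (free_diff n M) (precomp X (free_res_map n f) u) = 0).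
by rewrite -precomp_comm (uZ : precomp X (free_diff n N) u = 0) linear0.
Qed.

Lemma Ext_map_coboundary n (u : homR (free_res n N) X) :
  coboundaries n N X u -> coboundaries n M X (precomp X (free_res_map n f) u).
Proof.
case: n u => [|n] u.
  by move=> u0; rewrite (u0 : u = 0); exact: linear0.
by move=> [v _ <-]; exists (precomp X (free_res_map n f) v); rewrite ?precomp_comm.
Qed.

Definition Ext_map (n : nat) : {linear Ext n N X -> Ext n M X} :=
  subquot_map (@Ext_map_cocycle n) (@Ext_map_coboundary n).
End ExtMap.

End Ext.

Section LocalCohomology.
Context (R : comNzRingType) (a : set R).

Definition expM (k : nat) (M : lmodType R) : submod M :=
  Submod (set_scale_submod (ideal_exp a k) (@setT_submod R M)).

Lemma expM_S k (M : lmodType R) (v : M) : expM k.+1 M v -> expM k M v.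
Proof.
by move=> [m [r [u [ar _ ->]]]]; exists m, r, u; split=> // i; exact: ideal_expS.
Qed.

Definition quo_proj (k : nat) (M : lmodType R) :
    {linear quom (expM k.+1 M) -> quom (expM k M)} :=
  quom_map (f := idfun) (@expM_S k M).

Definition gen_local_cohomology (n : nat) (M X : lmodType R) : lmodType R :=
  direct_limit (E := fun k => Ext n (quom (expM k M)) X)
    (fun k => Ext_map X (quo_proj k M) n).

Definition local_cohomology (n : nat) (X : lmodType R) : lmodType R :=
  gen_local_cohomology n R^o X.

End LocalCohomology.

(* Main.v *)
Require Import Defs.
From HB Require Import structures.
From mathcomp Require Import all_boot all_algebra.
From mathcomp Require Import finmap.
From mathcomp Require Import boolp classical_sets.
From mathcomp.multinomials Require Import monalg.

(** The first inclusion is what the spectral sequence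
    [Ext^p(M, H^q_a(X)) => H^(p+q)_a(M, X)] gives: its abutment in degree [n] is
    filtered with quotients that are subquotients of the [Ext^(n-i)(M, H^i_a(X))].
    Here the filtration is built one step at a time, by induction on [n].

    Let [Gamma(X)] be the submodule of elements killed by a power of [a]. Over a
    Noetherian ring the torsion part of an injective module is injective
    ([torsion_part_injective], by a form of the Artin-Rees lemma), hence a direct
    summand. So there is an exact sequence
      [0 -> Gamma(X) -> X -> E -> X' -> 0]
    with [E] injective and torsion-free ([torsionfree_quotient]). All [Ext] of
    [M / a^k M] into [E] vanish: in positive degree because [E] is injective, in
    degree 0 because [E] is torsion-free. On the other hand, a class of
    [H^n_a(M, Gamma(X))] whose image in [Ext^n(M, Gamma(X))] is zero is itself
    zero ([ext_triv_torsion]). Three facts follow.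
    - [H^0_a(X)] is [Gamma(X)] ([annihilator_local_cohomology0]).
    - [H^(n+1)_a(X)] is isomorphic to [H^n_a(X')], because [Ext^m(R, Gamma(X))]
      vanishes for positive [m] ([annihilator_shift_Ext]).
    - If [s] kills [H^n_a(M, X')] and [r] kills [Ext^(n+1)(M, Gamma(X))], then
      [r * s] kills [H^(n+1)_a(M, X)] ([annihilator_shift]).
    Together they pass from the product for [X'] in degree [n] to the product for
    [X] in degree [n+1] ([annihilator_prod_Ext]).

    The canonical free resolution makes dimension shifting concrete: a class in
    [Ext^n(N, X)] is a linear map from the [n]-th syzygy module of [N] to [X],
    which is trivial when it extends to the free module containing these
    syzygies, or for [n = 0] when it vanishes ([ext_triv]). Isomorphisms between
    direct limits of such classes are handled as linear relations between
    representatives at a common level, which are bijective up to triviality at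
    higher levels.

    Injective modules come from Baer's criterion ([baer_injective]) and from a
    countable chain of pushouts, which suffices because ideals are finitely
    generated ([enough_baer]). *)

Set Implicit Arguments.
Unset Strict Implicit.
Unset Printing Implicit Defensive.

Import GRing.Theory.
Local Open Scope classical_set_scope.
Local Open Scope ring_scope.

(** * Submodules and ideals *)

Lemma ord_common_bound m (P : 'I_m -> nat -> Prop) :
  (forall i k l, (k <= l)%N -> P i k -> P i l) ->
  (forall i, exists k, P i k) -> exists k, forall i, P i k.
Proof.
move=> Pmono /choice [k kP]; exists (\max_i k i) => i.
exact: Pmono (leq_bigmax i) (kP i).
Qed.

Section Submodules.
Context (R : comNzRingType).

Lemma submodD (V : lmodType R) (N : set V) u v :
  is_submod N -> N u -> N v -> N (u + v).
Proof. by move=> [_ NZ] Nu Nv; rewrite -[u]scale1r; exact: NZ. Qed.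

Lemma submodZ (V : lmodType R) (N : set V) c u :
  is_submod N -> N u -> N (c *: u).
Proof. by move=> [N0 NZ] Nu; rewrite -[_ *: _]addr0; exact: NZ. Qed.

Lemma submodB (V : lmodType R) (N : set V) u v :
  is_submod N -> N u -> N v -> N (u - v).
Proof.
move=> sN Nu Nv; apply: submodD => //.
by rewrite -scaleN1r; exact: submodZ.
Qed.

Lemma generator_mem (V : lmodType R) (N : set V) m (g : 'I_m -> V) i :
  N = [set v | exists c : 'I_m -> R, v = \sum_(j < m) c j *: g j] -> N (g i).
Proof.
move=> ->; exists (fun j => (j == i)%:R).
rewrite (bigD1 i) //= eqxx scale1r big1 ?addr0 // => j /negbTE ->.
by rewrite scale0r.
Qed.

Lemma submod_sum (V : lmodType R) (N : set V) (I : eqType) (s : seq I)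
    (F : I -> V) :
  is_submod N -> (forall i, i \in s -> N (F i)) -> N (\sum_(i <- s) F i).
Proof.
move=> sN NF; rewrite big_seq; apply: (@big_ind _ N); first exact: sN.1.
- by move=> u v Nu Nv; exact: submodD.
- exact: NF.
Qed.

Lemma idealM (I : set R) c x : is_ideal I -> I x -> I (c * x).
Proof. exact: (@submodZ R^o). Qed.

Lemma set_scale_sub (V : lmodType R) (I : set R) (N P : set V) :
  is_submod P -> (forall r v, I r -> N v -> P (r *: v)) ->
  set_scale I N `<=` P.
Proof.
move=> sP IN _ [m [r [u [Ir Nu ->]]]].
by apply: submod_sum => // i _; exact: IN.
Qed.

Lemma ideal_mul_sub (I J P : set R) :
  is_ideal P -> (forall x y, I x -> J y -> P (x * y)) -> ideal_mul I J `<=` P.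
Proof. exact: (@set_scale_sub R^o). Qed.

Lemma mem_ideal_mul (I J : set R) x y : I x -> J y -> ideal_mul I J (x * y).
Proof.
move=> Ix Jy; exists 1, (fun=> x), (fun=> y); split=> //.
by rewrite big_ord1.
Qed.

Lemma ideal_mul_mono (I J J' : set R) :
  J `<=` J' -> ideal_mul I J `<=` ideal_mul I J'.
Proof.
by move=> JJ' _ [m [r [u [Ir Ju ->]]]]; exists m, r, u; split=> // i; exact: JJ'.
Qed.

Lemma ideal_exp_le (I : set R) k l : (k <= l)%N ->
  ideal_exp I l `<=` ideal_exp I k.
Proof.
move=> /subnK <-; elim: (l - k)%N => // j IHj.
by apply: subset_trans IHj; exact: ideal_expS.
Qed.

Lemma ideal_exp_pow (I : set R) c k : I c -> ideal_exp I k (c ^+ k).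
Proof. by move=> Ic; elim: k => // k IHk; rewrite exprS; exact: mem_ideal_mul. Qed.

Definition colon (Q : set R) (c : R) : set R := [set x | Q (c * x)].

Lemma colon_ideal Q c : is_ideal Q -> is_ideal (colon Q c).
Proof.
move=> iQ; split=> [|d x y Qx Qy]; first by rewrite /colon /= mulr0; case: iQ.
change (Q (c * (d * (x : R) + (y : R)))).
by rewrite mulrDr mulrCA; apply: (@submodD R^o) => //; exact: idealM.
Qed.

Definition ideal_add (I J : set R) : set R :=
  [set z | exists x y, [/\ I x, J y & z = x + y]].

Lemma ideal_add_ideal I J : is_ideal I -> is_ideal J -> is_ideal (ideal_add I J).
Proof.
move=> iI iJ; split; first by exists 0, 0; rewrite addr0; split=> //; [case: iI|case: iJ].
move=> c _ _ [x [y [Ix Jy ->]]] [x' [y' [Ix' Jy' ->]]].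
exists (c * x + x'), (c * y + y'); split.
- by case: iI => _; apply.
- by case: iJ => _; apply.
- by rewrite scalerDr addrACA.
Qed.

Definition principal (c : R) : set R := [set x | exists r, x = r * c].

Lemma principal_ideal c : is_ideal (principal c).
Proof.
split; first by exists 0; rewrite mul0r.
by move=> d _ _ [r ->] [s ->]; exists (d * r + s); rewrite mulrDl -mulrA.
Qed.

(** Each factor in turn is moved from the first power into the ideal [Q], which
    is replaced by its colon ideal. *)
Lemma ideal_expD_sub (I Q : set R) u t : is_ideal Q ->
  (forall x y, ideal_exp I u x -> ideal_exp I t y -> Q (x * y)) ->
  ideal_exp I (u + t) `<=` Q.
Proof.
elim: u Q => [|u IHu] Q iQ H; first by move=> y It; rewrite -[y]mul1r; exact: H.
apply: ideal_mul_sub => // r y Ir; apply: (IHu (colon Q r)).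
  exact: colon_ideal.
move=> x z Ix Iz; rewrite /colon /= mulrA; apply: H => //.
exact: mem_ideal_mul.
Qed.

Section Noetherian.
Hypothesis noethR : noetherian R.

(** The union of a chain of ideals is finitely generated, hence equal to a
    member of the chain; so Zorn's lemma applies to every family of ideals. *)
Lemma noetherian_max (P : set (set R)) (I0 : set R) :
  (forall I, P I -> is_ideal I) -> P I0 ->
  exists2 Q, P Q & forall J, P J -> Q `<=` J -> J `<=` Q.
Proof.
move=> idP PI0; pose P' (A : set R) := A = set0 \/ P A.
have chainP F : F `<=` P' -> total_on F subset -> P' (\bigcup_(X in F) X).
  move=> FP Ftot; set U := \bigcup_(X in F) X.
  have [U0|/set0P [z [A0 FA0 A0z]]] := eqVneq U set0; first by left.
  have mem_id A : F A -> A !=set0 -> P A.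
    by move=> /FP [->|//] [? []].
  have PA0 : P A0 by apply: mem_id => //; exists z.
  have common A B : F A -> F B -> exists2 C, F C & A `|` B `<=` C.
    move=> FA FB; case: (Ftot A B FA FB) => AB.
      by exists B => // x [/AB|].
    by exists A => // x [|/AB].
  have iU : is_ideal U.
    split; first by exists A0 => //; case: (idP _ PA0).
    move=> c u v [A FA Au] [B FB Bv]; have [C FC ABC] := common A B FA FB.
    have Cu : C u by apply: ABC; left.
    have Cv : C v by apply: ABC; right.
    have PC : P C by apply: mem_id => //; exists u.
    by exists C => //; case: (idP _ PC) => _; apply.
  have [m [g Ug]] := noethR iU.
  have /choice [h hP] : forall i, exists A, F A /\ A (g i).
    by move=> i; have [A FA Ag] := generator_mem i Ug; exists A.
  have [C FC hC] : exists2 C, F C & A0 `<=` C /\ forall i, h i `<=` C.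
    have [C FC [A0C sC]] : exists2 C, F C & A0 `<=` C /\
        forall i, i \in enum 'I_m -> h i `<=` C.
      elim: (enum 'I_m) => [|i s [C FC [A0C sC]]]; first by exists A0 => //; split.
      have [B FB CB] := common C (h i) FC (hP i).1.
      exists B => //; split=> [x Ax|j]; first by apply: CB; left; exact: A0C.
      rewrite inE => /orP[/eqP ->|js] x hx; apply: CB; first by right.
      by left; exact: (sC j).
    by exists C => //; split=> // i; apply: sC; rewrite mem_enum.
  have PC : P C by apply: mem_id => //; exists z; exact: hC.1.
  right; suff -> : U = C by [].
  rewrite eqEsubset; split=> [x|x Cx]; last by exists C.
  rewrite Ug => -[c ->]; apply: (@submod_sum R^o); first exact: idP.
  move=> i _; apply: (@submodZ R^o); first exact: idP.
  by apply: (hC.2 i); exact: (hP i).2.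
have [Q [P'Q Qmax]] := Zorn_bigcup chainP.
have PQ : P Q.
  case: P'Q => // Q0; exfalso; apply: (Qmax I0); last by right.
  rewrite Q0; split=> // /(_ 0) /=; apply.
  by case: (idP _ PI0).
exists Q => // J PJ QJ x Jx; apply: contrapT => nQx.
by apply: (Qmax J); [split=> // /(_ _ Jx)|right].
Qed.

(** Noetherian induction: let [J] be maximal among the ideals that contain a
    power of every element of [a] but no power of [a]. Some [c] in [a] is outside
    [J], and the last power [d] of [c] outside [J] satisfies [d * c] in [J]; so
    powers of [a] lie in the larger ideals [J + (d)] and [J : d], and the product
    of these powers lies in [J]. *)
Lemma ideal_exp_nilpotent (a Q : set R) : is_ideal a -> is_ideal Q ->
  (forall c, a c -> exists j, Q (c ^+ j)) -> exists t, ideal_exp a t `<=` Q.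
Proof.
move=> ia iQ nilQ; apply: contrapT => notQ.
pose P (J : set R) := [/\ is_ideal J, forall c, a c -> exists j, J (c ^+ j)
  & ~ exists t, ideal_exp a t `<=` J].
have [||{notQ nilQ}J [iJ nilJ notJ] Jmax] := @noetherian_max P Q; first by move=> I [].
  by [].
have enlarge J' : is_ideal J' -> J `<=` J' -> (exists2 x, J' x & ~ J x) ->
    exists t, ideal_exp a t `<=` J'.
  move=> iJ' JJ' [x J'x nJx]; apply: contrapT => nt; apply: nJx.
  apply: (Jmax J') => //; split=> // c /nilJ [j Jc].
  by exists j; exact: JJ'.
apply: notJ; have [aJ|] := pselect (a `<=` J).
  exists 1%N; apply: ideal_mul_sub => // x y /aJ Jx _.
  by rewrite mulrC; exact: idealM.
move=> /existsNP [c /not_implyP [ac nJc]].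
have [j Jcj jmin] : exists2 j, J (c ^+ j) & forall i, J (c ^+ i) -> (j <= i)%N.
  have exj : exists j, `[< J (c ^+ j) >].
    by have [j Jc] := nilJ c ac; exists j; exact/asboolP.
  case: (ex_minnP exj) => j /asboolP Jc jmin; exists j => // i Ji.
  by apply: jmin; exact/asboolP.
case: j Jcj jmin => [|j] Jcj jmin.
  by exfalso; apply: nJc; rewrite -[c]mulr1; exact: idealM.
have [t atJ] : exists t, ideal_exp a t `<=` ideal_add J (principal (c ^+ j)).
  apply: enlarge; first by apply: ideal_add_ideal => //; exact: principal_ideal.
    by move=> x Jx; exists x, 0; split; rewrite ?addr0 //; exists 0; rewrite mul0r.
  exists (c ^+ j); last by move=> /jmin; rewrite ltnn.
  exists 0, (c ^+ j); split; rewrite ?add0r //; first by case: iJ.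
  by exists 1; rewrite mul1r.
have [u auJ] : exists u, ideal_exp a u `<=` colon J (c ^+ j).
  apply: enlarge; first exact: colon_ideal.
    by move=> x Jx; exact: idealM.
  by exists c => //; rewrite /colon /= -exprSr.
exists (u + t)%N; apply: ideal_expD_sub => // x y /auJ Jx /atJ [y1 [_ [Jy1 [r ->] ->]]].
rewrite mulrDr; apply: (@submodD R^o) => //; first exact: idealM.
by rewrite mulrCA; apply: idealM => //; rewrite mulrC.
Qed.

(** A form of the Artin-Rees lemma. Take [Q] maximal with [Q] meeting [I] in
    [K]. For [c] in [a] the ideals [Q : c ^+ j] stabilize, and then
    [Q + (c ^+ j)] meets [I] in [K] as well, so [c ^+ j] lies in [Q]. *)
Lemma artin_rees (a I K : set R) s : is_ideal a -> is_ideal I -> is_ideal K ->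
  K `<=` I -> (forall x y, ideal_exp a s x -> I y -> K (x * y)) ->
  exists Q t, [/\ is_ideal Q, K `<=` Q, Q `&` I `<=` K & ideal_exp a t `<=` Q].
Proof.
move=> ia iI iK KI asI.
pose P (J : set R) := [/\ is_ideal J, K `<=` J & J `&` I `<=` K].
have [||Q [iQ KQ QI] Qmax] := @noetherian_max P K; first by move=> J [].
  by split=> // x [].
suff [t atQ] : exists t, ideal_exp a t `<=` Q by exists Q, t.
apply: ideal_exp_nilpotent => // c ac.
(* The exponents are at least [s], so that [c ^+ j] multiplies [I] into [K]. *)
pose C (J : set R) := exists2 j, (s <= j)%N & J = colon Q (c ^+ j).
have [||J [j sj ->] Cmax] := @noetherian_max C (colon Q (c ^+ s)).
- by move=> J [j _ ->]; exact: colon_ideal.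
- by exists s.
have stable r : Q (c ^+ j * (c ^+ j * r)) -> Q (c ^+ j * r).
  move=> Qr; apply: (Cmax (colon Q (c ^+ (j + j)))); last first.
  - by rewrite /colon /= exprD -mulrA.
  - by move=> x Qx; rewrite /colon /= exprD -mulrA; exact: idealM.
  - by exists (j + j)%N => //; rewrite (leq_trans sj) // leq_addr.
exists j; apply: (Qmax (ideal_add Q (principal (c ^+ j)))).
- split; first by apply: ideal_add_ideal => //; exact: principal_ideal.
    move=> x /KQ Qx; exists x, 0; split; rewrite ?addr0 //.
    by exists 0; rewrite mul0r.
  move=> y [[q [_ [Qq [r ->] yE]]] Iy]; apply: QI; split=> //.
  rewrite yE; apply: (@submodD R^o) => //; rewrite mulrC; apply: stable.
  have -> : c ^+ j * (c ^+ j * r) = c ^+ j * y - c ^+ j * q.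
    by rewrite yE mulrDr [r * _]mulrC addrC addKr.
  apply: (@submodB R^o) => //; last exact: idealM.
  by apply: KQ; apply: asI => //; apply: (ideal_exp_le sj); exact: ideal_exp_pow.
- move=> x Qx; exists x, 0; split; rewrite ?addr0 //.
  by exists 0; rewrite mul0r.
- exists 0, (c ^+ j); split; rewrite ?add0r //; first by case: iQ.
  by exists 1; rewrite mul1r.
Qed.

End Noetherian.
End Submodules.

(** * Linear maps given by linear relations *)

Section LinearMaps.
Context (R : comNzRingType).

Definition lin_of (U V : lmodType R) (f : U -> V) (fL : linear f) :
    {linear U -> V} :=
  HB.pack f (GRing.isLinear.Build R U V _ _ fL).

(** This serves to define linear maps by their values on representatives: by
    linearity, independence of the choices need only be checked at 0. *)
Lemma linear_relation (U V : lmodType R) (G : U -> V -> Prop) :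
  (forall u, exists v, G u v) ->
  (forall c u v u' v', G u v -> G u' v' -> G (c *: u + u') (c *: v + v')) ->
  (forall v, G 0 v -> v = 0) ->
  exists f : {linear U -> V}, forall u, G u (f u).
Proof.
move=> /choice [f Gf] GZ G0.
have Guniq u v v' : G u v -> G u v' -> v = v'.
  move=> Gv Gv'; apply/eqP; rewrite -subr_eq0; apply/eqP/G0.
  have := GZ (-1) _ _ _ _ Gv' Gv.
  by rewrite !scaleN1r addNr addrC.
have fL : linear f.
  by move=> c u v; apply: (Guniq (c *: u + v)); [exact: Gf|exact: GZ].
by exists (lin_of fL).
Qed.

Lemma range_submod (U V : lmodType R) (f : {linear U -> V}) :
  is_submod (range f).
Proof.
split; first by exists 0; rewrite ?linear0.
by move=> c _ _ [u _ <-] [v _ <-]; exists (c *: u + v); rewrite ?linearP.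
Qed.

Lemma quom_pi0 (V : lmodType R) (N : submod V) v : quom_pi N v = 0 <-> N v.
Proof. by rewrite -[0](linear0 (quom_pi N)) quom_eqP subr0. Qed.

Lemma quom_surj (V : lmodType R) (N : submod V) (x : quom N) :
  exists v, x = quom_pi N v.
Proof. by exists (quom_repr x); rewrite quom_reprK. Qed.

Lemma quom_lift (V W : lmodType R) (N : submod V) (f : {linear V -> W}) :
  (forall v, N v -> f v = 0) ->
  exists g : {linear quom N -> W}, forall v, g (quom_pi N v) = f v.
Proof.
move=> fN.
have [||| g gP] := @linear_relation (quom N) W
    (fun x w => exists2 v, x = quom_pi N v & w = f v).
- by move=> x; have [v ->] := quom_surj x; exists (f v), v.
- move=> c _ _ _ _ [u -> ->] [v -> ->].
  by exists (c *: u + v); rewrite linearP.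
- by move=> _ [v /esym /quom_pi0 Nv ->]; exact: fN.
exists g => v; have [u /esym uv ->] := gP (quom_pi N v).
apply/eqP; rewrite -subr_eq0 -linearB; apply/eqP/fN.
exact/quom_eqP.
Qed.

End LinearMaps.

(** * Elements of a sequential direct limit *)

Section DirectLimit.
Context (R : comNzRingType) (E : nat -> lmodType R).
Context (t : forall k, {linear E k -> E k.+1}).

Fixpoint trans (k j : nat) : {linear E k -> E (j + k)%N} :=
  match j return {linear E k -> E (j + k)%N} with
  | 0 => idfun
  | j'.+1 => t (j' + k) \o trans k j'
  end.

Definition single (k : nat) (x : E k) : dprod E :=
  dfwith (fun l => 0 : E l) x.

Lemma single_in k (x : E k) : single x k = x.
Proof. exact: dfwith_in. Qed.

Lemma single_out k (x : E k) l : k != l -> single x l = 0.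
Proof. exact: dfwith_out. Qed.

Lemma single_finite_supp k (x : E k) : finite_supp (single x).
Proof.
by exists k.+1 => l kl; rewrite single_out // neq_ltn kl.
Qed.

Lemma single_linear k c (x y : E k) : single (c *: x + y) = c *: single x + single y.
Proof.
apply: functional_extensionality_dep => l.
change (single (c *: x + y) l = c *: single x l + single y l).
have [kl|kl] := eqVneq k l; first by subst l; rewrite !single_in.
by rewrite !single_out // scaler0 addr0.
Qed.

Definition limit_supp := Submod (finite_supp_submod E).
Definition limit_rels := Submod (subquot_is_submod limit_supp
  (Submod (limit_rel_submod t))).

Definition to_lim_fun k (x : E k) : direct_limit t :=
  quom_pi limit_rels (submk (N := limit_supp) (single_finite_supp x)).

Lemma to_lim_linear k : linear (@to_lim_fun k).
Proof.
move=> c x y; rewrite /to_lim_fun -linearP; congr quom_pi.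
by apply: val_inj; rewrite /= single_linear.
Qed.

Definition to_lim k : {linear E k -> direct_limit t} := lin_of (@to_lim_linear k).

Lemma shift_single k (x : E k) : shift t (single x) = single (t k x).
Proof.
apply: functional_extensionality_dep => -[|l] /=; first by rewrite single_out.
have [kl|kl] := eqVneq k l; first by subst l; rewrite !single_in.
by rewrite !single_out // linear0.
Qed.

Lemma to_limS k (x : E k) : to_lim k.+1 (t k x) = to_lim k x.
Proof.
apply/esym/quom_eqP; exists (single x); first exact: single_finite_supp.
by rewrite shift_single.
Qed.

Lemma to_lim_trans k j (x : E k) : to_lim (j + k) (trans k j x) = to_lim k x.
Proof. by elim: j => // j <-; exact: (to_limS (trans k j x)). Qed.

(** Writing [single x] as [w - shift w], the components of [w] are those of the
    orbit of [x] under the transition maps, and they vanish eventually. *)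
Lemma to_lim_eq0 k (x : E k) : to_lim k x = 0 <-> exists j, trans k j x = 0.
Proof.
split; last by move=> [j xj]; rewrite -(to_lim_trans j) xj linear0.
move=> /quom_pi0 [w [K wK] wx].
have wE l : single x l = w l - shift t w l by rewrite -[single x]wx.
have w_lt l : (l < k)%N -> w l = 0.
  elim: l => [|l IHl] lk.
    by have := wE 0%N; rewrite single_out ?neq_ltn ?lk ?orbT //= subr0 => <-.
  have := wE l.+1; rewrite single_out ?neq_ltn ?lk ?orbT //=.
  by rewrite (IHl (ltnW lk)) linear0 subr0 => <-.
have shift0 l : (forall l', (l' < l)%N -> w l' = 0) -> shift t w l = 0.
  by case: l => //= l wl; rewrite wl ?linear0.
have w_ge j : w (j + k)%N = trans k j x.
  elim: j => [|j IHj].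
    by have := wE k; rewrite single_in shift0 ?subr0.
  have := wE (j.+1 + k)%N; rewrite single_out ?neq_ltn ?addSn ?ltnS ?leq_addl //=.
  by move=> /esym/eqP; rewrite subr_eq0 => /eqP ->; rewrite IHj.
by exists K; rewrite -w_ge wK // leq_addr.
Qed.

Lemma to_limD_ex k l (x : E k) (y : E l) :
  exists m z, to_lim k x + to_lim l y = to_lim m z.
Proof.
wlog kl : k l x y / (k <= l)%N.
  move=> H; have [|/ltnW] := leqP k l; first exact: H.
  by rewrite addrC; exact: H.
have {kl} := subnK kl; move: (l - k)%N => j lE; subst l.
by exists (j + k)%N, (trans k j x + y); rewrite linearD to_lim_trans.
Qed.

(** The components of an element of the direct sum are removed one at a time and
    collected in a class coming from a single level. *)
Lemma to_lim_surj (x : direct_limit t) : exists k y, x = to_lim k y.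
Proof.
have [s ->] := quom_surj x; have [K sK] := subm_valP s.
suff : forall n, exists k y (u : subm limit_supp),
    [/\ quom_pi limit_rels s = to_lim k y + quom_pi _ u,
       forall l, (l < n)%N -> val u l = 0 & forall l, (K <= l)%N -> val u l = 0].
  move=> /(_ K) [k [y [u [-> ult uge]]]].
  exists k, y; suff -> : u = 0 by rewrite linear0 addr0.
  apply: val_inj; apply: functional_extensionality_dep => l.
  by have [/uge|/ult] := leqP K l.
elim=> [|n [k [y [u [sE ult uge]]]]].
  by exists 0%N, 0, s; split=> //; rewrite linear0 add0r.
have [m [z zE]] := to_limD_ex y (val u n : E n).
pose d : subm limit_supp := submk (N := limit_supp) (single_finite_supp (val u n : E n)).
have dE l : val (u - d) l = val u l - single (val u n : E n) l by [].
exists m, z, (u - d); split.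
- rewrite -zE sE -addrA; congr (_ + _).
  by rewrite linearB /= addrC subrK.
- move=> l; rewrite ltnS leq_eqVlt dE => /orP[/eqP ->|ln].
    by rewrite single_in subrr.
  by rewrite ult // single_out ?subr0 // neq_ltn ln orbT.
- move=> l Kl; rewrite dE uge // sub0r.
  have [nl|nl] := eqVneq n l; last by rewrite single_out ?oppr0.
  by subst l; rewrite single_in uge ?oppr0.
Qed.

Lemma to_lim_inj k : (forall l, injective (t l)) -> injective (to_lim k).
Proof.
move=> tinj; have transinj j : forall x : E k, trans k j x = 0 -> x = 0.
  elim: j => //= j IHj x; rewrite -(linear0 (t (j + k))) => /tinj; exact: IHj.
move=> x y xy; apply/eqP; rewrite -subr_eq0; apply/eqP.
have /to_lim_eq0 [j] : to_lim k (x - y) = 0 by rewrite linearB xy subrr.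
exact: transinj.
Qed.

End DirectLimit.

Arguments trans {R E} t k j.
Arguments to_lim {R E} t k.

(** * Injective modules *)

Section InjectiveModules.
Context (R : comNzRingType).

Definition linear_on (U V : lmodType R) (N : set U) (f : U -> V) : Prop :=
  forall c u v, N u -> N v -> f (c *: u + v) = c *: f u + f v.

Definition injective_mod (E : lmodType R) : Prop :=
  forall (V : lmodType R) (N : set V) (f : V -> E), is_submod N ->
  linear_on N f -> exists F : {linear V -> E}, forall v, N v -> F v = f v.

Definition baer (E : lmodType R) : Prop :=
  forall (I : set R) (f : R -> E), is_ideal I ->
  linear_on (I : set R^o) (f : R^o -> E) ->
  exists e, forall x, I x -> f x = x *: e.

Lemma linear_on0 (U V : lmodType R) (N : set U) (f : U -> V) :
  N 0 -> linear_on N f -> f 0 = 0.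
Proof.
move=> N0 /(_ (-1) 0 0 N0 N0).
by rewrite scaler0 addr0 scaleN1r addNr.
Qed.

(** Baer's criterion. Partial linear maps are ordered as graphs. A maximal one
    is defined on every [v], since the map on the ideal of all [r] with [r *: v]
    in the domain is multiplication by some [e], which may be taken as the value
    at [v]. *)
Lemma baer_injective (E : lmodType R) : baer E -> injective_mod E.
Proof.
move=> baerE V N f sN fN; have [N0 NZ] := sN.
pose G0 : set (V * E) := [set p | N p.1 /\ p.2 = f p.1].
pose good (G : set (V * E)) := is_submod G /\ forall e, G (0, e) -> e = 0.
have good0 : good G0.
  split=> [|e [_ /= ->]]; last exact: linear_on0 fN.
  split=> [|c [u x] [v y] [/= Nu ->] [/= Nv ->]].
    by split=> //=; rewrite (linear_on0 N0 fN).
  by split=> /=; [exact: NZ|rewrite fN].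
(* Zorn's lemma is applied to the parts added to [G0], so that the empty chain
   needs no separate bound. *)
pose P (A : set (V * E)) := good (G0 `|` A).
have chainP F : F `<=` P -> total_on F subset -> P (\bigcup_(X in F) X).
  move=> FP Ftot; have [F0|/set0P [A0 FA0]] := eqVneq F set0.
    by rewrite /P F0 bigcup_set0 setU0.
  have sub A : F A -> G0 `|` A `<=` G0 `|` \bigcup_(X in F) X.
    by move=> FA p [|Ap]; [left|right; exists A].
  have cover p q : (G0 `|` \bigcup_(X in F) X) p ->
      (G0 `|` \bigcup_(X in F) X) q ->
      exists A, [/\ F A, (G0 `|` A) p & (G0 `|` A) q].
    move=> [Gp|[A FA Ap]] [Gq|[B FB Bq]].
    - by exists A0; split=> //; left.
    - by exists B; split=> //; [left|right].
    - by exists A; split=> //; [right|left].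
    - case: (Ftot A B FA FB) => AB; [exists B|exists A]; split=> //; right => //;
      exact: AB.
  split; last first.
    by move=> e He; have [A [/FP [_ A1] Ae _]] := cover _ _ He He; exact: A1.
  split; first by left; case: good0 => -[].
  move=> c p q Gp Gq; have [A [FA Ap Aq]] := cover _ _ Gp Gq.
  by apply: (sub A) => //; have [[_ AZ] _] := FP A FA; exact: AZ.
have [A [PA maxA]] := Zorn_bigcup chainP.
set G := G0 `|` A in PA; have [sG G1] := PA.
have GN v : N v -> G (v, f v) by move=> Nv; left.
have Gtot v : exists e, G (v, e).
  pose I : set R := [set r | exists e, G (r *: v, e)].
  have iI : is_ideal I.
    split; first by exists 0; rewrite scale0r; case: sG.
    move=> c r s [e Ge] [d Gd]; exists (c *: e + d).
    rewrite scalerDl [c *: r]/(c * (r : R)) -scalerA.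
    by case: sG => _ /(_ c _ _ Ge Gd).
  have /choice [h hP] : forall r, exists e, I r -> G (r *: v, e).
    by move=> r; have [[e Ge]|nI] := pselect (I r); [exists e|exists 0].
  have Guniq u e d : G (u, e) -> G (u, d) -> e = d.
    move=> Ge Gd; apply/eqP; rewrite -subr_eq0; apply/eqP/G1.
    by have : G (u - u, e - d) := submodB sG Ge Gd; rewrite subrr.
  have [|e eP] := baerE I h iI.
    move=> c r s Ir Is; apply: (Guniq ((c * r + s) *: v)).
      apply: hP; case: iI => _; exact.
    rewrite scalerDl -scalerA.
    by case: sG => _ /(_ c _ _ (hP r Ir) (hP s Is)).
  pose G' : set (V * E) :=
    [set p | exists u d r, G (u, d) /\ p = (u + r *: v, d + r *: e)].
  have GG' : G `<=` G'.
    by move=> [u d] Gp; exists u, d, 0; rewrite !scale0r !addr0.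
  have goodG' : good G'.
    split; first split; first by apply: GG'; case: sG.
      move=> c _ _ [u [d [r [Gp ->]]]] [u' [d' [r' [Gp' ->]]]].
      exists (c *: u + u'), (c *: d + d'), (c * r + r'); split.
        by case: sG => _ /(_ c _ _ Gp Gp').
      by congr pair; rewrite /= scalerDl scalerDr scalerA addrACA.
    move=> x [u [d [r [Gud [/esym/eqP]]]]]; rewrite addr_eq0 => /eqP uE ->.
    have Gr : G (r *: v, - d).
      have : G (-1 *: u, -1 *: d) := submodZ (-1) sG Gud.
      by rewrite !scaleN1r uE opprK.
    have Ir : I r by exists (- d).
    by rewrite -eP // (Guniq _ _ _ (hP r Ir) Gr) subrr.
  exists e; apply: contrapT => nG; apply: (maxA G'); last first.
    by rewrite /P setUidr // => p Gp; apply: GG'; left.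
  split=> [p Ap|G'A]; first by apply: GG'; right.
  apply: nG; right; apply: G'A.
  exists 0, 0, 1; rewrite !scale1r !add0r; split=> //.
  by case: sG.
have [||| F FG] := @linear_relation R V E (fun v e => G (v, e)) => //.
  by move=> c u x v y Gu Gv; case: sG => _ /(_ c _ _ Gu Gv).
exists F => v Nv; apply/eqP; rewrite -subr_eq0; apply/eqP/G1.
have : G (v - v, F v - f v) := submodB sG (FG v) (GN v Nv).
by rewrite subrr.
Qed.

End InjectiveModules.

Section Enlarge.
Context (R : comNzRingType) (V : lmodType R).

(** All functions are allowed as indices; those that are not linear on an ideal
    are neutralized in [im_dom] and [im_fun]. *)
Definition ideal_map_index : choiceType := {classic (set R * (R -> V))%type}.

Definition is_ideal_map (s : ideal_map_index) : Prop :=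
  is_ideal s.1 /\ linear_on (s.1 : set R^o) (s.2 : R^o -> V).

Definition im_dom (s : ideal_map_index) : set R :=
  if `[< is_ideal_map s >] then s.1 else [set 0].
Definition im_fun (s : ideal_map_index) (x : R) : V :=
  if `[< is_ideal_map s >] then s.2 x else 0.

Lemma im_dom_ideal s : is_ideal (im_dom s).
Proof.
rewrite /im_dom; case: asboolP => [[]//|_]; split=> // c u v -> ->.
by rewrite scaler0 addr0.
Qed.

Lemma im_fun_linear s : linear_on (im_dom s : set R^o) (im_fun s : R^o -> V).
Proof.
rewrite /im_dom /im_fun => c u v; case: asboolP => [[_ sL]|_ _ _]; first exact: sL.
by rewrite scaler0 addr0.
Qed.

Lemma im_fun0 s : im_fun s 0 = 0.
Proof.
by apply: (linear_on0 (N := im_dom s : set R^o)); [case: (im_dom_ideal s)|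
  exact: im_fun_linear].
Qed.

Notation F := {malg R[ideal_map_index]}.

Definition im_sum (w : F) : V := \sum_(s <- msupp w) im_fun s (w@_s).

Lemma im_sumE (w : F) (D : {fset ideal_map_index}) :
  (msupp w `<=` D)%fset -> im_sum w = \sum_(s <- D) im_fun s (w@_s).
Proof.
move=> wD; rewrite /im_sum (big_fset_incl _ wD) //= => s _.
by rewrite -mcoeff_eq0 => /eqP ->; rewrite im_fun0.
Qed.

(** The relations of a pushout: for every map [f] on an ideal and every [x] in
    it, the value [f x] becomes [x] times the basis vector attached to [f]. They
    are described by their second component [w], whose vanishing forces the
    first one to vanish; so [V] embeds in the quotient. *)
Definition enlarge_rel : set (V * F) :=
  [set p | (forall s, im_dom s (p.2@_s)) /\ p.1 = - im_sum p.2].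

Lemma enlarge_rel_submod : is_submod enlarge_rel.
Proof.
split=> [|c [v w] [v' w'] [/= Iw ->] [/= Iw' ->]].
  split=> [s|] /=; first by rewrite mcoeff0; case: (im_dom_ideal s).
  by rewrite /im_sum msupp0 big_seq_fset0 oppr0.
split=> [s|] /=.
  by rewrite mcoeffD mcoeffZ; case: (im_dom_ideal s) => _; exact.
pose D := (msupp w `|` msupp w')%fset.
have wD : (msupp w `<=` D)%fset by exact: fsubsetUl.
have w'D : (msupp w' `<=` D)%fset by exact: fsubsetUr.
have sD : (msupp (c *: w + w') `<=` D)%fset.
  by rewrite (fsubset_trans (msuppD_le _ _))// fsetUSS// msuppZ_le.
rewrite !(im_sumE (D := D)) // scalerN -opprD scaler_sumr -big_split /=.
by congr (- _); apply: eq_bigr => s _; rewrite mcoeffD mcoeffZ im_fun_linear.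
Qed.

Definition enlarge_submod := Submod enlarge_rel_submod.
Definition enlarge : lmodType R := quom enlarge_submod.

Definition to_enlarge_fun (v : V) : enlarge := quom_pi enlarge_submod (v, 0).

Lemma to_enlarge_linear : linear to_enlarge_fun.
Proof.
move=> c u v; rewrite /to_enlarge_fun -linearP; congr quom_pi.
by congr pair; rewrite /= scaler0 addr0.
Qed.

Definition to_enlarge : {linear V -> enlarge} := lin_of to_enlarge_linear.

Lemma to_enlarge_inj : injective to_enlarge.
Proof.
move=> u v /quom_eqP [_ /= uv]; apply/eqP; rewrite -subr_eq0; apply/eqP.
move: uv; rewrite /im_sum subr0 msupp0 big_seq_fset0 oppr0.
exact.
Qed.

Lemma to_enlarge_extends (I : set R) (f : R -> V) :
  is_ideal I -> linear_on (I : set R^o) (f : R^o -> V) ->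
  exists e, forall x, I x -> to_enlarge (f x) = x *: e.
Proof.
move=> iI fL; pose s : ideal_map_index := (I, f).
have gs : is_ideal_map s by [].
exists (quom_pi enlarge_submod (0, << s >>)) => x Ix.
rewrite -linearZ; apply/quom_eqP.
have -> : (f x, 0) - x *: (0, << s >>) = (f x, - << x *g s >>) :> (V * F)%type.
  congr pair; rewrite /= ?scaler0 ?subr0 // sub0r; congr (- _).
  by apply/malgP => y; rewrite mcoeffZ !mcoeffU; case: eqP; rewrite ?mulr1 ?mulr0.
split=> [u|] /=.
  rewrite mcoeffN mcoeffU; case: eqP => [<-|_]; last first.
    by rewrite mulr0n oppr0; case: (im_dom_ideal u).
  rewrite mulr1n /im_dom asboolT //.
  by have := @submodZ R R^o I (-1) x iI Ix; rewrite scaleN1r.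
rewrite (im_sumE (D := [fset s]%fset)); last first.
  by rewrite msuppN msuppU_le.
rewrite big_seq_fset1 mcoeffN mcoeffUU /im_fun asboolT //=.
have := fL (-1) x 0 Ix (iI.1); rewrite (linear_on0 iI.1 fL) !addr0 !scaleN1r => ->.
by rewrite opprK.
Qed.

End Enlarge.

Section EnoughInjectives.
Context (R : comNzRingType) (noethR : noetherian R).

(** The small object argument: a linear map from a finitely generated ideal to
    the limit of the chain of enlargements takes its values in some term of the
    chain, hence extends in the next term. *)
Lemma enough_baer (V : lmodType R) :
  exists (E : lmodType R) (j : {linear V -> E}), injective j /\ baer E.
Proof.
pose C k := iter k (@enlarge R) V.
pose t k : {linear C k -> C k.+1} := to_enlarge (C k).
have tinj k : injective (t k) by exact: to_enlarge_inj.
have iinj k : injective (to_lim t k) by exact: to_lim_inj.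
exists (direct_limit t), (to_lim t 0%N); split; first exact: (iinj 0%N).
move=> I f iI fL.
have [m [g Ig]] := noethR iI.
have [k kP] : exists k, forall i, exists y, f (g i) = to_lim t k y.
  apply: ord_common_bound => [i k l kl [y ->]|i]; last exact: to_lim_surj.
  by rewrite -(subnK kl) -(to_lim_trans t (l - k)); eexists.
have /choice [h hP] : forall x, exists y, I x -> f x = to_lim t k y.
  move=> x; have [Ix|nIx] := pselect (I x); last by exists 0.
  suff [_ [y _ <-]] : I x /\ range (to_lim t k) (f x) by exists y.
  pose J : set R^o := [set z | I z /\ range (to_lim t k) (f z)].
  have sJ : is_submod J.
    have [r0 rZ] := range_submod (to_lim t k).
    split; first by split; [case: iI|rewrite (linear_on0 iI.1 fL)].
    move=> c u v [Iu ru] [Iv rv]; split; first by case: iI => _; exact.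
    by rewrite fL //; exact: rZ.
  move: Ix; rewrite {1}Ig => -[c ->]; apply: (submod_sum (N := J)) => // i _.
  apply: (submodZ (N := J) (c i) sJ); split; first exact: generator_mem Ig.
  by have [y ->] := kP i; exists y.
have [|e eP] := to_enlarge_extends (f := h) iI.
  move=> c u v Iu Iv; apply: (iinj k).
  by rewrite linearP -!hP //; [exact: fL|case: iI => _; exact].
exists (to_lim t k.+1 e) => x Ix.
by rewrite -linearZ -eP // to_limS -hP.
Qed.

Lemma enough_injectives (V : lmodType R) :
  exists (E : lmodType R) (j : {linear V -> E}), injective j /\ injective_mod E.
Proof.
have [E [j [jinj bE]]] := enough_baer V.
by exists E, j; split=> //; exact: baer_injective.
Qed.

End EnoughInjectives.

(** * Torsion modules over a Noetherian ring *)

Section Torsion.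
Context (R : comNzRingType) (a : set R).

Definition tors (V : lmodType R) : set V :=
  [set x | exists k, forall r, ideal_exp a k r -> r *: x = 0].

Lemma tors_submod (V : lmodType R) : is_submod (@tors V).
Proof.
split; first by exists 0%N => r _; rewrite scaler0.
move=> c u v [k ku] [l lv]; exists (maxn k l) => r ar.
rewrite scalerDr scalerA mulrC -scalerA ku ?lv ?scaler0 ?addr0 //.
- exact: ideal_exp_le (leq_maxr k l) _ ar.
- exact: ideal_exp_le (leq_maxl k l) _ ar.
Qed.

Definition torsion_submod (V : lmodType R) : submod V := Submod (@tors_submod V).
Definition torsion_part (V : lmodType R) : lmodType R := subm (torsion_submod V).

Definition torsion_mod (T : lmodType R) : Prop := forall x : T, tors x.
Definition torsionfree (E : lmodType R) : Prop := forall x : E, tors x -> x = 0.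

Lemma tors_linear (U V : lmodType R) (f : {linear U -> V}) x :
  tors x -> tors (f x).
Proof.
by move=> [k kx]; exists k => r /kx rx; rewrite -linearZ rx linear0.
Qed.

Lemma tors_inj (U V : lmodType R) (f : {linear U -> V}) x :
  injective f -> tors (f x) -> tors x.
Proof.
move=> finj [k kx]; exists k => r /kx rx; apply: finj.
by rewrite linearZ /= rx linear0.
Qed.

Lemma torsion_partP (V : lmodType R) : torsion_mod (torsion_part V).
Proof.
move=> x; have [k kx] := subm_valP x; exists k => r /kx rx.
by apply: val_inj; rewrite /= rx.
Qed.

Lemma tors_fin (V : lmodType R) m (g : 'I_m -> V) : (forall i, tors (g i)) ->
  exists k, forall i r, ideal_exp a k r -> r *: g i = 0.
Proof.
move=> tg; apply: ord_common_bound => // i k l kl kg r ar.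
by apply: kg; exact: ideal_exp_le kl _ ar.
Qed.

Lemma injective_retract (E E' : lmodType R) (p : {linear E -> E'})
    (s : {linear E' -> E}) :
  cancel s p -> injective_mod E -> injective_mod E'.
Proof.
move=> sK injE V N f sN fN; have [|F FN] := injE V N (s \o f) sN.
  by move=> c u v Nu Nv /=; rewrite fN // linearP.
by exists (p \o F) => v /FN /= ->; rewrite sK.
Qed.

Context (noethR : noetherian R) (ideal_a : is_ideal a).

(** The kernel [K] of a map [f] from an ideal [I] to the torsion part contains
    [a ^ s * I] for some [s]. By the Artin-Rees property there is [Q] meeting
    [I] in [K] and containing [a ^ t]; extending [f] by zero on [Q] and then
    to the ring, the value at 1 is killed by [a ^ t]. *)
Lemma torsion_part_injective (E : lmodType R) :
  injective_mod E -> injective_mod (torsion_part E).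
Proof.
move=> injE; apply: baer_injective => I f iI fL.
have I0 := iI.1.
have [s sP] : exists s, forall x y, ideal_exp a s x -> I y -> x *: f y = 0.
  have [m [g Ig]] := noethR iI.
  have [s sP] := tors_fin (fun i => torsion_partP (f (g i))).
  exists s => x y ax; rewrite {1}Ig => -[c ->].
  pose J : set R^o := [set z | I z /\ x *: f z = 0].
  have sJ : is_submod J.
    split=> [|d u v [Iu xu] [Iv xv]]; first by rewrite /J /= (linear_on0 I0 fL) scaler0.
    split; first by case: iI => _; exact.
    by rewrite fL // scalerDr scalerA mulrC -scalerA xu xv scaler0 addr0.
  suff [] : J (\sum_i c i *: (g i : R^o)) by [].
  apply: (submod_sum (N := J)) => // i _; apply: (submodZ (N := J) _ sJ).
  by split; [exact: generator_mem Ig|exact: sP].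
pose K : set R := [set x | I x /\ f x = 0].
have iK : is_ideal K.
  split=> [|c u v [Iu fu] [Iv fv]]; first by split=> //; exact: (linear_on0 I0 fL).
  split; first by case: iI => _; exact.
  by rewrite fL // fu fv scaler0 addr0.
have fZ x y : I y -> f (x * y) = x *: f y.
  by move=> Iy; have := fL x y 0 Iy I0; rewrite (linear_on0 I0 fL) !addr0.
have fB x y : I x -> I y -> f (x - y) = f x - f y.
  move=> Ix Iy; have := fL (-1) y x Iy Ix.
  by rewrite !scaleN1r addrC => ->; rewrite addrC.
have [Q [t [iQ KQ QIK atQ]]] : exists Q t, [/\ is_ideal Q, K `<=` Q,
    Q `&` I `<=` K & ideal_exp a t `<=` Q].
  apply: (artin_rees noethR (s := s)) => //; first by move=> x [].
  by move=> x y ax Iy; split; [exact: idealM|rewrite fZ // sP].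
have /choice [h hP] : forall z, exists e : E, forall x q, I x -> Q q ->
    z = x + q -> e = val (f x).
  move=> z; have [[x [q [Ix Qq ->]]]|nz] := pselect (ideal_add I Q z); last first.
    by exists 0 => x q Ix Qq zE; exfalso; apply: nz; exists x, q.
  exists (val (f x)) => x' q' Ix' Qq' zE; congr val; apply/eqP.
  rewrite -subr_eq0 -fB //; apply/eqP; apply: (QIK _ _).2; split; last first.
    exact: (@submodB R R^o).
  have -> : x - x' = q' - q.
    by apply/eqP; rewrite subr_eq addrAC eq_sym subr_eq addrC -zE addrC.
  exact: (@submodB R R^o).
have [|F FP] := injE R^o (ideal_add I Q) h (ideal_add_ideal iI iQ).
  move=> c _ _ [x [q [Ix Qq ->]]] [x' [q' [Ix' Qq' ->]]].
  rewrite (hP (x + q) x q) // (hP (x' + q') x' q') //.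
  rewrite (hP _ (c * x + x') (c * q + q')).
  - by rewrite fL.
  - by case: iI => _; exact.
  - by case: iQ => _; exact.
  - by rewrite scalerDr addrACA.
have FE x : F x = x *: F 1 by rewrite -linearZ [x *: 1]mulr1.
have Ft : torsion_submod E (F 1).
  exists t => r /atQ Qr; rewrite -FE FP; last by exists 0, r; rewrite add0r.
  rewrite (hP r 0 r) //; last by rewrite add0r.
  by rewrite (linear_on0 I0 fL).
exists (submk Ft) => x Ix; apply: val_inj.
rewrite /= -FE FP; last by exists x, 0; rewrite addr0; split=> //; case: iQ.
by rewrite (hP x x 0) ?addr0 //; case: iQ.
Qed.

(** The image of [T] in an injective module lies in the torsion part, which is
    again injective. *)
Lemma torsion_embedding (T : lmodType R) : torsion_mod T ->
  exists (J : lmodType R) (j : {linear T -> J}),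
  [/\ injective j, injective_mod J & torsion_mod J].
Proof.
move=> torsT; have [E [j [jinj injE]]] := enough_injectives noethR T.
have [|||f fP] := @linear_relation R T (torsion_part E) (fun x y => j x = val y).
- by move=> x; exists (submk (N := torsion_submod E) (tors_linear j (torsT x))).
- by move=> c u v u' v' /= <- <-; rewrite linearP.
- by move=> v; rewrite linear0 => v0; exact: val_inj.
exists (torsion_part E), f; split.
- by move=> x y xy; apply: jinj; rewrite !fP xy.
- exact: torsion_part_injective.
- exact: torsion_partP.
Qed.

(** The injective torsion part of an injective module [E] is a direct summand,
    and its complement is torsion-free and injective. *)
Lemma torsionfree_quotient (X : lmodType R) :
  exists (E : lmodType R) (phi : {linear X -> E}),
  [/\ injective_mod E, torsionfree E & forall x, phi x = 0 <-> tors x].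
Proof.
have [E [j [jinj injE]]] := enough_injectives noethR X.
have [rho rhoP] : exists rho : {linear E -> torsion_part E},
    forall e, tors e -> val (rho e) = e.
  have := torsion_part_injective injE.
  have /choice [f fP] : forall e, exists y : torsion_part E, tors e -> val y = e.
    move=> e; have [te|nte] := pselect (tors e); last by exists 0.
    by exists (submk (N := torsion_submod E) te).
  move=> /(_ E _ f (@tors_submod E)) [|rho rhoP].
    move=> c u v tu tv; apply: val_inj; rewrite /= !fP //.
    exact: (tors_submod E).2.
  by exists rho => e te; rewrite rhoP // fP.
pose C := kernel rho.
have CP e : C (e - val (rho e)).
  change (rho (e - val (rho e)) = 0); rewrite linearB; apply/eqP; rewrite subr_eq0.
  by apply/eqP/val_inj/esym/rhoP; exact: (subm_valP (rho e)).
have [|||p pP] := @linear_relation R E (subm C) (fun e y => val y = e - val (rho e)).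
- by move=> e; exists (submk (CP e)).
- move=> c u v u' v' /= -> ->; rewrite linearP /= scalerBr opprD addrACA //.
- by move=> v; rewrite linear0 subr0 => v0; exact: val_inj.
exists (subm C), (p \o j); split.
- apply: (injective_retract (p := p) (s := subm_val C)) injE => x.
  apply: val_inj; rewrite pP (_ : rho _ = 0) ?subr0 //; exact: (subm_valP x).
- move=> x tx; apply: val_inj; rewrite /= -(rhoP (val x)).
    by rewrite (_ : rho _ = 0) //; exact: (subm_valP x).
  exact: (tors_linear (subm_val C)).
- move=> x; split=> [px0|tx].
    apply: (tors_inj jinj).
    have : j x - val (rho (j x)) = 0 by rewrite -pP; move: px0 => /= ->.
    by move=> /eqP; rewrite subr_eq0 => /eqP ->; exact: (subm_valP (rho (j x))).
  by apply: val_inj; rewrite /= pP rhoP ?subrr //; exact: tors_linear.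
Qed.

End Torsion.

(** * Extension classes as maps on syzygies *)

Section FreeModules.
Context (R : comNzRingType).

Lemma augU (V : lmodType R) (x : V) : aug V << x >> = x.
Proof. exact: free_liftU. Qed.

Lemma aug_surj (V : lmodType R) (x : V) : exists w, x = aug V w.
Proof. by exists << x >>; rewrite augU. Qed.

Lemma aug_descent (V X : lmodType R) (u : {linear {malg R[V]} -> X}) :
  (forall w, aug V w = 0 -> u w = 0) ->
  exists g : {linear V -> X}, forall w, g (aug V w) = u w.
Proof.
move=> u0; have [|||g gP] := @linear_relation R V X
    (fun x y => exists2 w, x = aug V w & y = u w).
- by move=> x; have [w ->] := aug_surj x; exists (u w), w.
- by move=> c _ _ _ _ [w -> ->] [w' -> ->]; exists (c *: w + w'); rewrite linearP.
- by move=> _ [w /esym w0 ->]; exact: u0.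
exists g => w; have [w' ww' ->] := gP (aug V w).
apply/eqP; rewrite -subr_eq0 -linearB; apply/eqP/u0.
by rewrite linearB ww' subrr.
Qed.

Lemma free_lift_through (S : choiceType) (Y Z : lmodType R)
    (p : {linear Y -> Z}) (u : {linear {malg R[S]} -> Z}) :
  (forall w, exists y, p y = u w) ->
  exists h : {linear {malg R[S]} -> Y}, forall w, p (h w) = u w.
Proof.
move=> pu; have /choice [h hP] : forall s : S, exists y, p y = u << s >>.
  by move=> s; exact: pu.
exists (free_lift h); apply: (malg_linear_ext (f := p \o free_lift h)) => s.
by change (p (free_lift h << s >>) = u << s >>); rewrite free_liftU hP.
Qed.

Lemma free_map_comp (U V W : lmodType R) (f : U -> V) (g : V -> W) (h : U -> W) w :
  (forall x, h x = g (f x)) -> free_map h w = free_map g (free_map f w).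
Proof.
move=> hE; move: w.
apply: (malg_linear_ext (f := free_map h) (g := free_map g \o free_map f)) => x.
change (free_map h << x >> = free_map g (free_map f << x >>)).
by rewrite /free_map !free_liftU hE.
Qed.

Lemma free_map_id (V : lmodType R) (f : V -> V) w :
  (forall x, f x = x) -> free_map f w = w.
Proof.
move=> fE; move: w.
apply: (malg_linear_ext (f := free_map f) (g := idfun)) => x.
by rewrite /free_map free_liftU fE.
Qed.

Lemma syz_map_comp n (U V W : lmodType R) (f : {linear U -> V})
    (g : {linear V -> W}) (h : {linear U -> W}) x :
  (forall x, h x = g (f x)) -> syz_map n h x = syz_map n g (syz_map n f x).
Proof.
move=> hE; elim: n x => [|n IHn] x; first exact: hE.
by apply: val_inj; exact: (free_map_comp (val x) IHn).
Qed.

Lemma syz_map_id n (V : lmodType R) (f : {linear V -> V}) x :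
  (forall x, f x = x) -> syz_map n f x = x.
Proof.
move=> fE; elim: n x => [|n IHn] x; first exact: fE.
by apply: val_inj; exact: (free_map_id (val x) IHn).
Qed.

Lemma aug_free_res_map n (U V : lmodType R) (f : {linear U -> V}) w :
  aug (syz n V) (free_res_map n f w) = syz_map n f (aug (syz n U) w).
Proof. exact: aug_free_map. Qed.

End FreeModules.

Section ExtClasses.
Context (R : comNzRingType).

Lemma linear_fun (U V : lmodType R) (f : {linear U -> V}) : linear f.
Proof. by move=> c u v; rewrite linearP. Qed.

Definition hom_of (U V : lmodType R) (f : {linear U -> V}) : homR U V :=
  submk (N := Submod (linear_submod U V)) (linear_fun f).

Definition cochain n (N X : lmodType R) (g : {linear syz n N -> X}) :
    homR (free_res n N) X :=
  hom_of (g \o aug (syz n N)).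

Lemma cochain_cocycle n (N X : lmodType R) (g : {linear syz n N -> X}) :
  cocycles n N X (cochain g).
Proof.
apply: val_inj; apply/funext => w.
change (g (aug (syz n N) (free_diff n N w)) = 0).
by rewrite free_diffE kernelP linear0.
Qed.

Definition ext_cls n (N X : lmodType R) (g : {linear syz n N -> X}) : Ext n N X :=
  quom_pi (Submod (subquot_is_submod (cocycles n N X) (coboundaries n N X)))
    (submk (cochain_cocycle g)).

(** As the [n]-th syzygy module is the cokernel of the differential into
    [free_res n N], classes in [Ext n N X] are given by linear maps on it; such
    a map gives zero when it extends to the free module containing the
    syzygies, or in degree 0 when it vanishes. *)
Definition ext_triv n (N X : lmodType R) : (syz n N -> X) -> Prop :=
  match n return (syz n N -> X) -> Prop with
  | 0 => fun g => forall x, g x = 0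
  | m.+1 => fun g => exists h : {linear free_res m N -> X},
      forall x : syz m.+1 N, g x = h (val x)
  end.

Lemma ext_cls_eq0 n (N X : lmodType R) (g : {linear syz n N -> X}) :
  ext_cls g = 0 <-> ext_triv g.
Proof.
rewrite /ext_cls quom_pi0 /=.
case: n g => [|n] g.
  split=> [g0 x|g0].
    have [w ->] := aug_surj x.
    by have : val (cochain g) w = 0 by rewrite (g0 : cochain g = 0).
  apply: val_inj; apply/funext => w; exact: g0.
split=> [[v _ vg]|[h hg]].
  exists (lin_of (subm_valP v)) => x; have [w ->] := aug_surj x.
  by change (val (cochain g) w = val v (free_diff n N w)); rewrite -vg.
exists (hom_of h) => //; apply: val_inj; apply/funext => w.
by rewrite precompE; exact/esym/hg.
Qed.

Lemma ext_cls_linear n (N X : lmodType R) c (g g' g'' : {linear syz n N -> X}) :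
  (forall x, g'' x = c *: g x + g' x) ->
  ext_cls g'' = c *: ext_cls g + ext_cls g'.
Proof.
move=> gE; rewrite /ext_cls -linearP; congr quom_pi.
by apply: val_inj; apply: val_inj; apply/funext => w; exact: gE.
Qed.

Lemma eq_ext_cls n (N X : lmodType R) (g g' : {linear syz n N -> X}) :
  g =1 g' -> ext_cls g = ext_cls g'.
Proof.
move=> gg'; congr quom_pi.
by apply: val_inj; apply: val_inj; apply/funext => w; exact: gg'.
Qed.

(** A cocycle vanishes on the image of the next differential, which is the
    kernel of the cover of the syzygy module. *)
Lemma ext_cls_surj n (N X : lmodType R) (x : Ext n N X) : exists g, x = ext_cls g.
Proof.
have [u ->] := quom_surj x; have uZ := subm_valP u.
have [|g gP] := @aug_descent R (syz n N) X (lin_of (subm_valP (val u))).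
  move=> w w0.
  have [w' wE] := aug_surj (submk (N := kernel (aug (syz n N))) w0 : syz n.+1 N).
  have -> : w = free_diff n N w' by rewrite free_diffE -wE.
  by change (val (precomp X (free_diff n N) (val u)) w' = 0); rewrite (uZ : _ = 0).
exists g; congr quom_pi; apply: val_inj; apply: val_inj; apply/funext => w.
exact/esym/gP.
Qed.

Lemma Ext_map_cls n (M N X : lmodType R) (f : {linear M -> N})
    (g : {linear syz n N -> X}) :
  Ext_map X f n (ext_cls g) = ext_cls (g \o syz_map n f).
Proof.
apply: etrans (quom_map_pi _ _) _.
  by move=> u; exact: Ext_map_coboundary.
apply: (congr1 (quom_pi _)).
apply: val_inj; apply: val_inj; apply/funext => w.
change (g (aug _ (free_res_map n f w)) = g (syz_map n f (aug _ w))).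
by rewrite aug_free_res_map.
Qed.

Lemma eq_ext_triv n (N X : lmodType R) (g g' : syz n N -> X) :
  g =1 g' -> ext_triv g -> ext_triv g'.
Proof.
case: n g g' => [|n] g g' gg' /=; first by move=> g0 x; rewrite -gg'.
by move=> [h hP]; exists h => x; rewrite -gg'.
Qed.

Lemma ext_triv_linear n (N X : lmodType R) c (g g' : syz n N -> X) :
  ext_triv g -> ext_triv g' -> ext_triv (fun x => c *: g x + g' x).
Proof.
case: n g g' => [|n] g g' /=.
  by move=> g0 g'0 x; rewrite g0 g'0 scaler0 addr0.
move=> [h hP] [h' h'P].
by exists ((c \*: h) \+ h') => x; rewrite hP h'P.
Qed.

Lemma ext_triv0 n (N X : lmodType R) : ext_triv (fun _ : syz n N => 0 : X).
Proof.
by case: n => [|n] //=; exists (\0 : {linear free_res n N -> X}).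
Qed.

Lemma ext_trivZ n (N X : lmodType R) c (g : syz n N -> X) :
  ext_triv g -> ext_triv (fun x => c *: g x).
Proof.
move=> g0; apply: eq_ext_triv (ext_triv_linear c g0 (@ext_triv0 n N X)) => x.
by rewrite addr0.
Qed.

Lemma ext_triv_pushforward n (N X Y : lmodType R) (p : {linear X -> Y})
    (g : syz n N -> X) :
  ext_triv g -> ext_triv (fun x => p (g x)).
Proof.
case: n g => [|n] g /=; first by move=> g0 x; rewrite g0 linear0.
by move=> [h hP]; exists (p \o h) => x; rewrite hP.
Qed.

(** In positive degree the syzygies form a submodule of a free module, to which
    maps with injective target extend. *)
Lemma ext_triv_injective n (N E : lmodType R) (g : {linear syz n.+1 N -> E}) :
  injective_mod E -> ext_triv g.
Proof.
move=> injE; pose K := kernel (aug (syz n N)).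
have /choice [f fP] : forall w, exists e, forall Kw : K w, e = g (submk Kw).
  move=> w; have [Kw|nKw] := pselect (K w); last by exists 0.
  by exists (g (submk Kw)) => Kw'; congr (g _); exact: val_inj.
have [|h hP] := injE _ K f (submodP K).
  move=> c u v Ku Kv; have Kuv := (submodP K).2 c u v Ku Kv.
  rewrite (fP _ Ku) (fP _ Kv) (fP _ Kuv) -linearP; congr (g _).
  exact: val_inj.
exists h => x; rewrite hP ?(fP _ (subm_valP x)); last exact: subm_valP.
by congr (g _); exact: val_inj.
Qed.

Lemma ext_clsZ n (N X : lmodType R) c (g : {linear syz n N -> X}) :
  ext_cls (c \*: g) = c *: ext_cls g.
Proof.
have z0 : ext_cls (\0 : {linear syz n N -> X}) = 0.
  by apply/ext_cls_eq0; exact: ext_triv0.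
rewrite -[RHS]addr0 -z0; apply: ext_cls_linear => x.
by rewrite /= addr0.
Qed.

Lemma annihilator_Ext n (N X : lmodType R) r :
  annihilator (Ext n N X) r <->
  forall g : {linear syz n N -> X}, ext_triv (fun x => r *: g x).
Proof.
split=> [annr g|H x].
  by have := annr (ext_cls g); rewrite -ext_clsZ => /ext_cls_eq0.
by have [g ->] := ext_cls_surj x; rewrite -ext_clsZ; apply/ext_cls_eq0; exact: H.
Qed.

End ExtClasses.

(** * Classes in generalized local cohomology *)

Section LocalCohomologyClasses.
Context (R : comNzRingType) (a : set R) (n : nat) (M X : lmodType R).

Notation quo k := (quom (expM a k M)).
Notation sys := (fun k => Ext n (quo k) X).
Notation maps := (fun k => Ext_map X (quo_proj a k M) n).

Fixpoint level_map k j : {linear quo (j + k) -> quo k} :=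
  match j return {linear quo (j + k) -> quo k} with
  | 0 => idfun
  | j'.+1 => level_map k j' \o quo_proj a (j' + k) M
  end.

Lemma level_map_pi k j m : level_map k j (quom_pi _ m) = quom_pi _ m.
Proof.
elim: j => // j IHj; rewrite -IHj; congr (level_map k j _).
apply: quom_map_pi; exact: expM_S.
Qed.

(** The canonical resolution is functorial, so the composite of the transition
    maps is the pullback along the composite projection. *)
Lemma trans_cls k j (g : {linear syz n (quo k) -> X}) :
  trans (E := sys) maps k j (ext_cls g) = ext_cls (g \o syz_map n (level_map k j)).
Proof.
elim: j => [|j IHj]; first by apply: eq_ext_cls => x /=; rewrite syz_map_id.
change (Ext_map X (quo_proj a (j + k) M) n (trans (E := sys) maps k j (ext_cls g)) =
  ext_cls (g \o syz_map n (level_map k j.+1))).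
rewrite IHj Ext_map_cls; apply: eq_ext_cls => x /=; congr (g _).
exact/esym/syz_map_comp.
Qed.

Definition loc_cls k (g : {linear syz n (quo k) -> X}) :
    gen_local_cohomology a n M X :=
  to_lim (E := sys) maps k (ext_cls g).

Lemma loc_cls_surj x : exists k g, x = @loc_cls k g.
Proof.
have [k [y ->]] := to_lim_surj x; have [g ->] := ext_cls_surj y.
by exists k, g.
Qed.

Lemma loc_cls_level k j g :
  @loc_cls k g = @loc_cls (j + k) (g \o syz_map n (level_map k j)).
Proof.
apply: etrans (esym (to_lim_trans (E := sys) maps j (ext_cls g))) _.
by apply: (congr1 (to_lim (E := sys) maps (j + k))); exact: trans_cls.
Qed.

Lemma loc_cls_eq0 k g : @loc_cls k g = 0 <->
  exists j, ext_triv (fun x => g (syz_map n (level_map k j) x)).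
Proof.
have E j : trans (E := sys) maps k j (ext_cls g) = 0 <->
    ext_triv (fun x => g (syz_map n (level_map k j) x)).
  by rewrite trans_cls; exact: ext_cls_eq0.
split=> [/to_lim_eq0|] [j] gj; last apply/to_lim_eq0; exists j; exact/E.
Qed.

Lemma loc_cls_linear k c (g g' g'' : {linear syz n (quo k) -> X}) :
  (forall x, g'' x = c *: g x + g' x) ->
  @loc_cls k g'' = c *: loc_cls g + loc_cls g'.
Proof.
move=> gE; apply: etrans (linearP (to_lim (E := sys) maps k) _ _ _).
by apply: (congr1 (to_lim (E := sys) maps k)); exact: ext_cls_linear.
Qed.

Lemma loc_clsZ k c (g : {linear syz n (quo k) -> X}) :
  loc_cls (c \*: g) = c *: loc_cls g.
Proof.
apply: etrans (linearZ_LR (to_lim (E := sys) maps k) _ _).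
by apply: (congr1 (to_lim (E := sys) maps k)); exact: ext_clsZ.
Qed.

End LocalCohomologyClasses.

(** * Dimension shifting *)

Section DimensionShift.
Context (R : comNzRingType) (X E X' : lmodType R).
Context (phi : {linear X -> E}) (p : {linear E -> X'}).
Hypothesis p_surj : forall x, exists e, p e = x.
Hypothesis exact_E : forall e, p e = 0 <-> exists x, phi x = e.

(** For an exact sequence [X -> E -> X' -> 0] this relates a class in
    [Ext n N X'] to a class in [Ext n.+1 N X]; it is the connecting map of the
    long exact sequence when [phi] is injective. *)
Definition conn n (N : lmodType R) (g : syz n N -> X') (g2 : syz n.+1 N -> X) :=
  exists h : {linear free_res n N -> E},
    (forall w, p (h w) = g (aug (syz n N) w)) /\
    (forall y : syz n.+1 N, phi (g2 y) = h (val y)).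

Lemma conn_pullback n (N N' : lmodType R) (f : {linear N' -> N}) g g2 :
  @conn n N g g2 ->
  conn (fun x => g (syz_map n f x)) (fun y => g2 (syz_map n.+1 f y)).
Proof.
move=> [h [hg hg2]]; exists (h \o free_res_map n f); split=> [w|y] /=.
  by rewrite hg aug_free_res_map.
by rewrite hg2.
Qed.

Lemma conn_linear n (N : lmodType R) c g g2 g' g2' :
  @conn n N g g2 -> conn g' g2' ->
  conn (fun x => c *: g x + g' x) (fun y => c *: g2 y + g2' y).
Proof.
move=> [h [hg hg2]] [h' [hg' hg2']].
exists ((c \*: h) \+ h'); split=> [w|y] /=; first by rewrite linearP hg hg'.
by rewrite linearP hg2 hg2'.
Qed.

Lemma connZ n (N : lmodType R) c g g2 : @conn n N g g2 ->
  conn (fun x => c *: g x) (fun y => c *: g2 y).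
Proof.
move=> [h [hg hg2]]; exists (c \*: h); split=> [w|y] /=.
  by rewrite -hg; exact: linearZ_LR.
by rewrite -hg2; exact: linearZ_LR.
Qed.

(** [phi \o g2] extends to the free module because [E] is injective; modulo the
    image of [phi] the extension vanishes on the syzygies. *)
Lemma conn_exists n (N : lmodType R) (g2 : {linear syz n.+1 N -> X}) :
  injective_mod E -> exists g : {linear syz n N -> X'}, conn g g2.
Proof.
move=> injE; have [h hP] := ext_triv_injective (phi \o g2) injE.
have [|g gP] := @aug_descent R (syz n N) X' (p \o h).
  move=> w w0; apply/exact_E.
  exists (g2 (submk (N := kernel (aug (syz n N))) w0)).
  exact: hP.
by exists g, h; split=> [w|y]; [rewrite gP|exact: hP].
Qed.

(** If [f] lifts [g], then the witness [h] of the relation and the map induced by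
    [f] on the free module differ by a map into the image of [phi], which lifts
    to [X] by freeness. *)
Lemma conn_lift n (N : lmodType R) (g : syz n N -> X') g2 :
  conn g g2 -> (exists f : {linear syz n N -> E}, forall x, p (f x) = g x) ->
  exists h : {linear free_res n N -> X},
    forall y : syz n.+1 N, phi (h (val y)) = phi (g2 y).
Proof.
move=> [h [hg hg2]] [f fg].
have [|h1 h1P] := free_lift_through (p := phi) (u := h \- (f \o aug (syz n N))).
  by move=> w; apply/exact_E; rewrite /= linearB hg fg subrr.
exists h1 => y; rewrite h1P hg2.
change (h (val y) - f (aug (syz n N) (val y)) = h (val y)).
by rewrite (subm_valP y : aug _ _ = 0) linear0 subr0.
Qed.

(** Conversely, if [phi \o g2] extends to the free module as [phi \o h0], then
    [h - phi \o h0] vanishes on the syzygies and so descends to a lift of [g]. *)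
Lemma conn_descent n (N : lmodType R) (g : syz n N -> X') g2
    (h0 : {linear free_res n N -> X}) :
  conn g g2 -> (forall y : syz n.+1 N, phi (g2 y) = phi (h0 (val y))) ->
  exists f : {linear syz n N -> E}, forall x, p (f x) = g x.
Proof.
move=> [h [hg hg2]] h0P.
have [|f fP] := @aug_descent R (syz n N) E (h \- (phi \o h0)).
  move=> w w0; pose y : syz n.+1 N := submk (N := kernel (aug (syz n N))) w0.
  by have := hg2 y; rewrite h0P /= => ->; rewrite subrr.
exists f => x; have [w ->] := aug_surj x; rewrite fP /= linearB hg.
by rewrite (_ : p (phi _) = 0) ?subr0 //; apply/exact_E; eexists.
Qed.

Lemma ext_triv_lift n (N : lmodType R) (g : syz n N -> X') : ext_triv g ->
  exists f : {linear syz n N -> E}, forall x, p (f x) = g x.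
Proof.
case: n g => [|n] g /=.
  by move=> g0; exists (\0 : {linear N -> E}) => x; rewrite g0 /= linear0.
move=> [h hP]; have [|f fP] := free_lift_through (p := p) (u := h).
  by move=> w; exact: p_surj.
by exists (f \o subm_val _) => x; rewrite /= fP hP.
Qed.

End DimensionShift.

(** * Extensions of projective modules *)

Section SplitResolutions.
Context (R : comNzRingType).

(** The canonical cover by a free module splits exactly when the module is
    projective, and then all syzygies are projective too. *)
Definition aug_split (N : lmodType R) : Prop :=
  exists s : {linear N -> {malg R[N]}}, forall x, aug N (s x) = x.

Lemma aug_split_retract (N : lmodType R) : aug_split N ->
  exists rho : {linear {malg R[N]} -> subm (kernel (aug N))},
    forall y, rho (val y) = y.
Proof.
move=> [s sP]; pose K := kernel (aug N).
have [D DE] : exists D : {linear {malg R[N]} -> {malg R[N]}},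
    forall w, D w = w - s (aug N w) by exists (idfun \- (s \o aug N)).
have [|||rho rhoP] := @linear_relation R {malg R[N]} (subm K)
  (fun w y => val y = D w).
- move=> w; have Kw : K (D w).
    by change (aug N (D w) = 0); rewrite DE linearB sP subrr.
  by exists (submk Kw).
- by move=> c u v u' v' /= -> ->; rewrite linearP.
- by move=> v; rewrite linear0 => v0; exact: val_inj.
exists rho => y; apply: val_inj.
by rewrite rhoP DE (subm_valP y : aug _ _ = 0) linear0 subr0.
Qed.

Lemma aug_split_syz n (N : lmodType R) : aug_split N -> aug_split (syz n N).
Proof.
move=> sN; elim: n => //= n /aug_split_retract [rho rhoP].
have [|h hP] := free_lift_through (p := aug (syz n.+1 N)) (u := rho).
  by move=> w; have [v ->] := aug_surj (rho w); exists v.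
exists (h \o subm_val _) => x.
exact: etrans (hP (val x)) (rhoP x).
Qed.

Lemma ext_triv_split n (N X : lmodType R) (g : {linear syz n.+1 N -> X}) :
  aug_split N -> ext_triv g.
Proof.
move=> /(aug_split_syz n) /aug_split_retract [rho rhoP].
by exists (g \o rho) => x; congr (g _); exact/esym/rhoP.
Qed.

Lemma aug_split_regular : aug_split R^o.
Proof.
have sL : linear (fun c : R^o => (c : R) *: << (1 : R^o) >> : {malg R[R^o]}).
  by move=> c u v; rewrite scalerDl scalerA.
exists (lin_of sL) => c.
change (aug R^o (c *: << 1 >>) = c).
by apply: etrans (linearZ_LR (aug R^o) c _) _; rewrite augU; exact: mulr1.
Qed.

End SplitResolutions.

(** * The quotients by powers of an ideal *)

Section PowerQuotients.
Context (R : comNzRingType) (a : set R) (M : lmodType R).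

Lemma expM_scale k r (v : M) : ideal_exp a k r -> expM a k M (r *: v).
Proof.
move=> ar; exists 1%N, (fun=> r), (fun=> v); split=> //.
by rewrite big_ord1.
Qed.

Lemma expM_le k l (v : M) : (k <= l)%N -> expM a l M v -> expM a k M v.
Proof.
move=> kl [m [r [u [ar Mu ->]]]]; exists m, r, u; split=> // i.
exact: ideal_exp_le kl _ (ar i).
Qed.

Lemma power_quotient_torsion k : torsion_mod a (quom (expM a k M)).
Proof.
move=> x; exists k => r ar; have [v ->] := quom_surj x.
by rewrite -linearZ; apply/quom_pi0; exact: expM_scale.
Qed.

Lemma fin_gen_expM (J : lmodType R) (f : {linear M -> J}) :
  fin_gen [set: M] -> torsion_mod a J ->
  exists k, forall v, expM a k M v -> f v = 0.
Proof.
move=> [m [g gP]] tJ; have [k kP] := tors_fin (fun i => tJ (f (g i))).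
exists k => v; apply: (set_scale_sub (kernel f).(submodP)) => r u ar _.
have : [set: M] u by [].
rewrite gP => -[c ->]; change (f (r *: \sum_i c i *: g i) = 0).
rewrite scaler_sumr linear_sum big1 // => i _.
have rg : f (r *: g i) = 0 := etrans (linearZ_LR f r (g i)) (kP i r ar).
rewrite scalerA mulrC -scalerA; apply: etrans (linearZ_LR f _ _) _.
by rewrite rg scaler0.
Qed.

End PowerQuotients.

(** * Torsion coefficients *)

Section Vanishing.
Context (R : comNzRingType) (a : set R).
Context (noethR : noetherian R) (ideal_a : is_ideal a).

Lemma quom_range_exact (X E : lmodType R) (phi : {linear X -> E}) e :
  quom_pi (Submod (range_submod phi)) e = 0 <-> exists x, phi x = e.
Proof.
rewrite quom_pi0; split=> [[x _ <-]|[x <-]]; first by exists x.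
by exists x.
Qed.

Lemma quom_range_surj (X E : lmodType R) (phi : {linear X -> E}) x :
  exists e, quom_pi (Submod (range_submod phi)) e = x.
Proof. by have [e ->] := quom_surj x; exists e. Qed.

(** For torsion [T] the natural map from generalized local cohomology to
    [Ext m M T] is injective. Embedding [T] in a torsion injective module lowers
    the degree; in degree one the class on [M] lifts to a map from [M] to that
    injective module, which factors through some [M / a ^ k M] because [M] is
    finitely generated. *)
Lemma ext_triv_torsion m (M T : lmodType R) k
    (g : {linear syz m (quom (expM a k M)) -> T}) :
  fin_gen [set: M] -> torsion_mod a T ->
  ext_triv (fun x : syz m M => g (syz_map m (quom_pi (expM a k M)) x)) ->
  exists j, ext_triv (fun x => g (syz_map m (level_map a M k j) x)).
Proof.
move=> fgM; elim: m T g => [|m IHm] T g torsT.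
  move=> g0; exists 0%N => x /=; have [v ->] := quom_surj x.
  exact: g0.
move=> [h0 h0P]; have [J [i [iinj injJ torsJ]]] := torsion_embedding noethR ideal_a torsT.
set T' : lmodType R := quom (Submod (range_submod i)).
pose p : {linear J -> T'} := quom_pi _.
have p_surj x : exists e, p e = x by exact: quom_range_surj.
have exact_J e : p e = 0 <-> exists x, i x = e by exact: quom_range_exact.
have torsT' : torsion_mod a T'.
  by move=> x; have [e <-] := p_surj x; exact: tors_linear.
have [g' g'g] := conn_exists exact_J g injJ.
have [|f fP] := conn_descent exact_J (h0 := h0)
    (conn_pullback (quom_pi (expM a k M)) g'g).
  by move=> y; rewrite -h0P.
suff [j [f' f'P]] : exists j, exists f' : {linear syz m (quom (expM a (j + k) M)) -> J},
    forall x, p (f' x) = g' (syz_map m (level_map a M k j) x).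
  exists j; have [|h hP] := conn_lift exact_J
    (conn_pullback (level_map a M k j) g'g); first by exists f'.
  by exists h => y; apply: iinj; rewrite hP.
case: m IHm g h0 h0P g' g'g f fP => [|m] IHm g h0 h0P g' g'g f fP.
  have [l fl] := fin_gen_expM f fgM torsJ.
  have [|f' f'P] := quom_lift (N := expM a (l + k) M) (f := f).
    by move=> v lv; apply: fl; exact: expM_le (leq_addr k l) lv.
  exists l, f' => x; have [v ->] := quom_surj x.
  rewrite f'P fP; congr (g' _); apply: esym; exact: level_map_pi.
have [|j g'0] := IHm T' g' torsT'.
  apply: eq_ext_triv fP _; apply: ext_triv_pushforward.
  exact: ext_triv_injective.
by exists j; exact: (ext_triv_lift p_surj g'0).
Qed.

End Vanishing.

(** * The degree shift along a torsion-free injective module *)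

Section Shift.
Context (R : comNzRingType) (a : set R).
Context (noethR : noetherian R) (ideal_a : is_ideal a).
Context (X E : lmodType R) (phi : {linear X -> E}).
Hypothesis injE : injective_mod E.
Hypothesis tfE : torsionfree a E.
Hypothesis ker_phi : forall x, phi x = 0 <-> tors a x.

Let X' : lmodType R := quom (Submod (range_submod phi)).
Let p : {linear E -> X'} := quom_pi _.
Let p_surj x : exists e, p e = x := quom_range_surj x.
Let exact_E e : p e = 0 <-> exists x, phi x = e := quom_range_exact phi e.

Lemma tors_corestrict (U : lmodType R) (u : {linear U -> X}) :
  (forall x, phi (u x) = 0) ->
  exists v : {linear U -> torsion_part a X}, forall x, val (v x) = u x.
Proof.
move=> u0; have [|||v vP] := @linear_relation R U (torsion_part a X)
    (fun x y => u x = val y).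
- by move=> x; exists (submk (N := torsion_submod a X) ((ker_phi _).1 (u0 x))).
- by move=> c x y x' y' /= <- <-; rewrite linearP.
- by move=> y; rewrite linear0 => y0; exact: val_inj.
by exists v => x; rewrite vP.
Qed.

(** If [g2] agrees, up to torsion, with a map that extends to the free module,
    then its class comes from the torsion part of [X]. *)
Lemma ext_triv_mod_torsion n (M : lmodType R) k r
    (g2 : {linear syz n.+1 (quom (expM a k M)) -> X})
    (h : {linear free_res n (quom (expM a k M)) -> X}) :
  fin_gen [set: M] -> annihilator (Ext n.+1 M (torsion_part a X)) r ->
  (forall y : syz n.+1 (quom (expM a k M)), phi (h (val y)) = phi (g2 y)) ->
  exists j, ext_triv (fun x => r *: g2 (syz_map n.+1 (level_map a M k j) x)).
Proof.
move=> fgM /annihilator_Ext annr hP.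
have [|o oP] := tors_corestrict
    (u := g2 \- (h \o subm_val (kernel (aug (syz n (quom (expM a k M))))))).
  by move=> x; apply/eqP; rewrite linearB subr_eq0; apply/eqP/esym/hP.
have [|j] := ext_triv_torsion (g := r \*: o) noethR ideal_a fgM
    (@torsion_partP R a X).
  exact: (annr (o \o syz_map n.+1 (quom_pi (expM a k M)))).
move=> [q qP]; exists j.
exists (subm_val _ \o q \+ (r \*: (h \o free_res_map n (level_map a M k j)))) => x.
have /(congr1 val) := qP x; rewrite /= oP => <- /=.
by rewrite -scalerDr subrK.
Qed.

(** Write [x'] for the class over [X'] related to a class [x] over [X]. Once [s]
    kills [x'], the class [s *: x] comes from the torsion part of [X], and is
    killed by [r]. *)
Lemma annihilator_shift n (M : lmodType R) r s : fin_gen [set: M] ->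
  annihilator (Ext n.+1 M (torsion_part a X)) r ->
  annihilator (gen_local_cohomology a n M X') s ->
  annihilator (gen_local_cohomology a n.+1 M X) (r * s).
Proof.
move=> fgM annr anns y; have [k [g2 ->]] := loc_cls_surj y.
have [g gg2] := conn_exists exact_E g2 injE.
have [j sg] : exists j, ext_triv (fun x => s *: g (syz_map n (level_map a M k j) x)).
  by apply/(loc_cls_eq0 (s \*: g)); rewrite loc_clsZ; exact: anns.
have [f fP] := ext_triv_lift p_surj sg.
have sgg2 := conn_pullback (level_map a M k j) (connZ s gg2).
have [h hP] := conn_lift exact_E sgg2 (ex_intro _ f fP).
have [j' rg2] := ext_triv_mod_torsion
  (g2 := s \*: g2 \o syz_map n.+1 (level_map a M k j)) fgM annr hP.
rewrite -scalerA -loc_clsZ (loc_cls_level j) -loc_clsZ; apply/loc_cls_eq0.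
by exists j'.
Qed.

(** The isomorphism of the local cohomology of [X'] in degree [n] with that of
    [X] in degree [n.+1], seen at level [k]. In the direction of the connecting
    map a representative at a higher level may be needed, which makes a relation
    more convenient than a map. *)
Definition shift_pair n k (x : local_cohomology a n X')
    (y : local_cohomology a n.+1 X) : Prop :=
  exists (g : {linear syz n (quom (expM a k R^o)) -> X'})
         (g2 : {linear syz n.+1 (quom (expM a k R^o)) -> X}),
  [/\ x = loc_cls g, y = loc_cls g2 & conn phi p g g2].

Lemma shift_pair_le n k l x y : (k <= l)%N ->
  @shift_pair n k x y -> shift_pair l x y.
Proof.
move=> /subnK <- [g [g2 [-> -> gg2]]].
exists (g \o syz_map n (level_map a R^o k (l - k))).
exists (g2 \o syz_map n.+1 (level_map a R^o k (l - k))).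
by split; [exact: loc_cls_level|exact: loc_cls_level|exact: conn_pullback].
Qed.

Lemma shift_pair_linear n k c x y x' y' : @shift_pair n k x y ->
  shift_pair k x' y' -> shift_pair k (c *: x + x') (c *: y + y').
Proof.
move=> [g [g2 [-> -> gg2]]] [g' [g2' [-> -> gg2']]].
exists ((c \*: g) \+ g'), ((c \*: g2) \+ g2'); split.
- by apply/esym; exact: loc_cls_linear.
- by apply/esym; exact: loc_cls_linear.
- exact: conn_linear.
Qed.

Lemma fin_gen_regular : fin_gen [set: R^o].
Proof.
exists 1%N, (fun=> 1); apply/seteqP; split=> // x _.
by exists (fun=> x); rewrite big_ord1 [_ *: _]mulr1.
Qed.

Lemma annihilator_Ext_regular n (Y : lmodType R) :
  annihilator (Ext n.+1 R^o Y) = [set: R].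
Proof.
apply/seteqP; split=> // r _; apply/annihilator_Ext => g.
apply: (ext_trivZ r); apply: ext_triv_split; exact: aug_split_regular.
Qed.

Lemma shift_pair_left n x : exists k y, @shift_pair n k x y.
Proof.
have [k [g ->]] := loc_cls_surj x; set N := quom (expM a k R^o) in g *.
have [|h hg] := free_lift_through (p := p) (u := g \o aug (syz n N)).
  by move=> w; exact: p_surj.
have [|h2 h2P] := free_lift_through (p := phi)
    (u := h \o (subm_val (kernel (aug (syz n N))) \o aug (syz n.+1 N))).
  move=> w; apply/exact_E; rewrite hg.
  change (g (aug (syz n N) (subm_val (kernel (aug (syz n N))) (aug (syz n.+1 N) w))) = 0).
  by rewrite kernelP linear0.
(* The lift [h2] of the map on syzygies is defined modulo torsion, so it need
   not vanish on the next syzygies; at a higher level it can be corrected. *)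
have [|o oP] := tors_corestrict (u := h2 \o subm_val (kernel (aug (syz n.+1 N)))).
  move=> y; apply: etrans (h2P (val y)) _.
  change (h (val (aug (syz n.+1 N) (val y))) = 0).
  by rewrite (subm_valP y : aug _ _ = 0) linear0.
have [|j [q qP]] := ext_triv_torsion (m := n.+2) (g := o) noethR ideal_a
    fin_gen_regular (@torsion_partP R a X).
  exact: (ext_triv_split (o \o syz_map n.+2 (quom_pi (expM a k R^o)))
    (@aug_split_regular R)).
set lev := level_map a R^o k j; set N' := quom (expM a (j + k) R^o) in q qP lev *.
have [|g2 g2P] := @aug_descent R (syz n.+1 N') X
    ((h2 \o free_res_map n.+1 lev) \- (subm_val _ \o q)).
  move=> w w0; pose y : syz n.+2 N' := submk (N := kernel (aug (syz n.+1 N'))) w0.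
  have /(congr1 val) := qP y; rewrite oP => yP.
  by apply/eqP; rewrite subr_eq0; apply/eqP.
exists (j + k)%N, (loc_cls g2), (g \o syz_map n lev), g2; split=> //.
  exact: loc_cls_level.
exists (h \o free_res_map n lev); split=> [w|y].
  exact: etrans (hg _) (congr1 g (aug_free_res_map lev w)).
have [w ->] := aug_surj y; rewrite g2P.
change (phi (h2 (free_res_map n.+1 lev w) - val (q w)) =
  h (val (syz_map n.+1 lev (aug (syz n.+1 N') w)))).
rewrite linearB ((ker_phi _).2 (subm_valP (q w))) subr0 h2P.
by rewrite -aug_free_res_map.
Qed.

Lemma shift_pair_right n y : exists k x, @shift_pair n k x y.
Proof.
have [k [g2 ->]] := loc_cls_surj y.
have [g gg2] := conn_exists exact_E g2 injE.
by exists k, (loc_cls g), g, g2.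
Qed.

Lemma shift_pair0l n k y : @shift_pair n k 0 y -> y = 0.
Proof.
move=> [g [g2 [/esym /loc_cls_eq0 [j g0] -> gg2]]].
have [f fP] := ext_triv_lift p_surj g0.
have [h hP] := conn_lift exact_E (conn_pullback (level_map a R^o k j) gg2)
  (ex_intro _ f fP).
have ann1 : annihilator (Ext n.+1 R^o (torsion_part a X)) 1.
  by rewrite annihilator_Ext_regular.
have [j' g20] := ext_triv_mod_torsion
  (g2 := g2 \o syz_map n.+1 (level_map a R^o k j)) fin_gen_regular ann1 hP.
rewrite (loc_cls_level j); apply/loc_cls_eq0; exists j'.
by apply: eq_ext_triv g20 => z; rewrite scale1r.
Qed.

Lemma shift_pair0r n k x : @shift_pair n k x 0 -> x = 0.
Proof.
move=> [g [g2 [-> /esym /loc_cls_eq0 [j [h0 h0P]] gg2]]].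
have [|f fP] := conn_descent exact_E (h0 := h0)
    (conn_pullback (level_map a R^o k j) gg2).
  by move=> y; rewrite h0P.
apply/loc_cls_eq0; exists j; apply: eq_ext_triv fP _.
apply: ext_triv_pushforward.
case: n x g g2 h0 h0P gg2 f => [|n] x g g2 h0 h0P gg2 f.
  (* A map from the torsion module [R / a ^ k] to [E] is zero. *)
  move=> z; apply: tfE; apply: tors_linear; exact: power_quotient_torsion.
exact: ext_triv_injective.
Qed.

End Shift.

(** * Annihilators of extension modules *)

Section Transfer.
Context (R : comNzRingType).

Lemma annihilator_ideal (V : lmodType R) : is_ideal (annihilator V).
Proof.
split=> [v|c r s rV sV v]; first by rewrite scale0r.
by rewrite scalerDl [c *: r]/(c * (r : R)) -scalerA rV sV scaler0 addr0.
Qed.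

Lemma big_ideal_mul_mono n (I J : 'I_n -> set R) : (forall i, I i `<=` J i) ->
  \big[@ideal_mul R/[set: R]]_(i < n) I i `<=`
  \big[@ideal_mul R/[set: R]]_(i < n) J i.
Proof.
elim: n I J => [|n IHn] I J IJ; first by rewrite !big_ord0.
rewrite !big_ord_recl => _ [m [r [u [Ir Iu ->]]]]; exists m, r, u; split=> // i.
  exact: IJ.
by apply: IHn (Iu i) => j; exact: IJ.
Qed.

Lemma annihilator_sub_Ext n (M Y : lmodType R) :
  annihilator Y `<=` annihilator (Ext n M Y).
Proof.
move=> r rY; apply/annihilator_Ext => g.
apply: eq_ext_triv (@ext_triv0 R n M Y) => x.
by rewrite rY.
Qed.

(** A bijective linear relation is the graph of an isomorphism. *)
Lemma annihilator_Ext_transfer n (M A B : lmodType R) (G : A -> B -> Prop) :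
  (forall x, exists y, G x y) -> (forall y, exists x, G x y) ->
  (forall c x y x' y', G x y -> G x' y' -> G (c *: x + x') (c *: y + y')) ->
  (forall y, G 0 y -> y = 0) -> (forall x, G x 0 -> x = 0) ->
  annihilator (Ext n M A) `<=` annihilator (Ext n M B).
Proof.
move=> Gl Gr GZ G0l G0r r /annihilator_Ext annr; apply/annihilator_Ext => g.
have [f fP] := linear_relation Gl GZ G0l.
have [|||f' f'P] := @linear_relation R B A (fun y x => G x y).
- exact: Gr.
- by move=> c y x y' x'; exact: GZ.
- exact: G0r.
have fK y : f (f' y) = y.
  apply/eqP; rewrite -subr_eq0; apply/eqP/G0l.
  have := GZ (-1) _ _ _ _ (f'P y) (fP (f' y)).
  by rewrite !scaleN1r addNr addrC.
have := ext_triv_pushforward f (annr (f' \o g)).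
by apply: eq_ext_triv => x; rewrite linearZ /= fK.
Qed.

End Transfer.

(** * Annihilators of generalized local cohomology *)

Section Main.
Context (R : comNzRingType) (a : set R).
Context (noethR : noetherian R) (ideal_a : is_ideal a).

Lemma annihilator_shift_Ext m n (M X E : lmodType R) (phi : {linear X -> E}) :
  injective_mod E -> torsionfree a E -> (forall x, phi x = 0 <-> tors a x) ->
  annihilator (Ext m M (local_cohomology a n.+1 X)) `<=`
  annihilator (Ext m M (local_cohomology a n (quom (Submod (range_submod phi))))).
Proof.
move=> injE tfE ker_phi.
apply: (annihilator_Ext_transfer
  (G := fun y x => exists k, shift_pair (a := a) (phi := phi) k x y)).
- move=> y; have [k [x xy]] := shift_pair_right phi injE y; by exists x, k.
- move=> x; have [k [y xy]] := shift_pair_left noethR ideal_a ker_phi x; by exists y, k.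
- move=> c y x y' x' [k kP] [l lP]; exists (maxn k l).
  apply: shift_pair_linear.
    exact: shift_pair_le (leq_maxl k l) kP.
  exact: shift_pair_le (leq_maxr k l) lP.
- move=> x [k]; exact: (shift_pair0r injE tfE).
- move=> y [k]; exact: (shift_pair0l noethR ideal_a ker_phi).
Qed.

(** Degree-zero local cohomology is the torsion part: a map from [R / a ^ k] is
    given by the image of 1, which is killed by [a ^ k]. *)
Lemma annihilator_local_cohomology0 n (M X : lmodType R) :
  annihilator (Ext n M (local_cohomology a 0 X)) `<=`
  annihilator (Ext n M (torsion_part a X)).
Proof.
pose pi1 k : quom (expM a k R^o) := quom_pi _ (1 : R^o).
have lev1 k j : level_map a R^o k j (pi1 _) = pi1 k by exact: level_map_pi.
pose at_level k (x : local_cohomology a 0 X) (y : torsion_part a X) :=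
  exists2 g : {linear quom (expM a k R^o) -> X}, x = @loc_cls R a 0 R^o X k g &
    val y = g (pi1 k).
have at_le k l x y : (k <= l)%N -> at_level k x y -> at_level l x y.
  move=> /subnK <- [g -> yE]; exists (g \o level_map a R^o k (l - k)).
    exact: (@loc_cls_level R a 0 R^o X k (l - k) g).
  by rewrite /= lev1.
apply: (annihilator_Ext_transfer (G := fun x y => exists k, at_level k x y)).
- move=> x; have [k [g ->]] := loc_cls_surj x.
  have tg : torsion_submod a X (g (pi1 k)).
    exact/(tors_linear (g : {linear quom (expM a k R^o) -> X}))/power_quotient_torsion.
  by exists (submk tg), k, g.
- move=> y; have [k kP] := subm_valP y.
  have sL : linear (fun c : R^o => (c : R) *: val y).
    by move=> c u v; rewrite scalerDl scalerA.
  have [|g gP] := quom_lift (N := expM a k R^o) (f := lin_of sL).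
    move=> v [m [r [u [ar _ ->]]]]; apply: kP.
    apply: (@submod_sum R R^o); first exact: ideal_exp_ideal.
    move=> i _; change (ideal_exp a k (r i * u i)); rewrite mulrC.
    by apply: idealM; [exact: ideal_exp_ideal|exact: ar].
  exists (@loc_cls R a 0 R^o X k g), k, g => //.
  by rewrite gP /= scale1r.
- move=> c x y x' y' [k kP] [l lP]; exists (maxn k l).
  have [g -> yE] := at_le _ _ _ _ (leq_maxl k l) kP.
  have [g' -> y'E] := at_le _ _ _ _ (leq_maxr k l) lP.
  exists ((c \*: g) \+ g'); last by rewrite /= yE y'E.
  by apply/esym; exact: (@loc_cls_linear R a 0 R^o X).
- move=> y [k [g /esym /loc_cls_eq0 [j g0] yE]]; apply: val_inj.
  by rewrite yE -(lev1 k j); exact: g0.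
- move=> x [k [g -> g1]]; apply/(@loc_cls_eq0 R a 0 R^o X); exists 0%N => x0 /=.
  have [c ->] := quom_surj x0.
  have -> : quom_pi (expM a k R^o) c = (c : R) *: pi1 k.
    by rewrite /pi1 -linearZ /=; congr quom_pi; exact/esym/mulr1.
  by rewrite linearZ /= -g1 scaler0.
Qed.

(** A map from [M / a ^ k M] to [X] takes its values in the torsion part, and is
    determined by its restriction to [M]. *)
Lemma annihilator_gen_local_cohomology0 (M X : lmodType R) :
  annihilator (Ext 0 M (torsion_part a X)) `<=`
  annihilator (gen_local_cohomology a 0 M X).
Proof.
move=> r /annihilator_Ext annr x; have [k [g ->]] := loc_cls_surj x.
have [|||o oP] := @linear_relation R (quom (expM a k M)) (torsion_part a X)
    (fun z y => g z = val y).
- move=> z; have tz : torsion_submod a X (g z).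
    exact/(tors_linear (g : {linear quom (expM a k M) -> X}))/power_quotient_torsion.
  by exists (submk tz).
- by move=> c z y z' y' /= <- <-; rewrite linearP.
- by move=> y; rewrite linear0 => y0; exact: val_inj.
rewrite -loc_clsZ; apply/loc_cls_eq0; exists 0%N => z /=.
have [v ->] := quom_surj z; rewrite oP.
by have /(congr1 val) := annr (o \o quom_pi (expM a k M)) v.
Qed.

(** Induction on the degree, for all [X] at once: the factor of index 0 kills the
    contribution of the torsion part of [X], and the other factors are those of
    the cokernel [X'], with indices lowered by one. *)
Lemma annihilator_prod_Ext n (M X : lmodType R) : fin_gen [set: M] ->
  \big[@ideal_mul R/[set: R]]_(i < n.+1)
      annihilator (Ext (n - i) M (local_cohomology a i X))
    `<=` annihilator (gen_local_cohomology a n M X).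
Proof.
move=> fgM; elim: n X => [|n IHn] X.
  rewrite big_ord_recl big_ord0; apply: ideal_mul_sub => [|r s rann _].
    exact: annihilator_ideal.
  rewrite mulrC; apply: (idealM s (annihilator_ideal _)).
  apply: annihilator_gen_local_cohomology0.
  exact: annihilator_local_cohomology0.
rewrite big_ord_recl; apply: ideal_mul_sub => [|r s rann sann].
  exact: annihilator_ideal.
have [E [phi [injE tfE ker_phi]]] := torsionfree_quotient noethR ideal_a X.
apply: (annihilator_shift noethR ideal_a injE ker_phi fgM).
  exact: annihilator_local_cohomology0.
apply: IHn; apply: big_ideal_mul_mono sann => i.
rewrite lift0 subSS; exact: annihilator_shift_Ext.
Qed.

End Main.

Lemma big_ideal_mul_truncate (R : comNzRingType) (m n : nat) (I : nat -> set R) :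
  (m <= n)%N -> \big[@ideal_mul R/[set: R]]_(i < n) I i `<=`
  \big[@ideal_mul R/[set: R]]_(i < m) I i.
Proof.
elim: m n I => [|m IHm] n I; first by move=> _; rewrite [X in _ `<=` X]big_ord0.
case: n => // n mn.
rewrite !big_ord_recl; apply: (@ideal_mul_mono R (I 0%N)).
exact: (IHm n (fun i => I i.+1)).
Qed.

Theorem corollary3p4 (R : comNzRingType) (a : set R) (M X : lmodType R) (n : nat)
    (noethR : noetherian R) (ideal_a : is_ideal a) (fgM : fin_gen [set: M]) :
  \big[@ideal_mul R/[set: R]]_(i < n.+1)
      annihilator (Ext (n - i) M (local_cohomology a i X))
    `<=` annihilator (gen_local_cohomology a n M X)
  /\
  \big[@ideal_mul R/[set: R]]_(i < n.+1) annihilator (local_cohomology a i X)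
    `<=` \bigcap_(i < n.+1) annihilator (gen_local_cohomology a i M X).
Proof.
(* For the second inclusion the product is truncated at [m]; the annihilator of
   a module kills its extension modules, so the first inclusion applies. *)
split; first exact: annihilator_prod_Ext.
move=> r rI m /= mn; apply: annihilator_prod_Ext => //.
have := big_ideal_mul_truncate
  (I := fun i => annihilator (local_cohomology a i X)) mn rI.
by apply: big_ideal_mul_mono => i; exact: annihilator_sub_Ext.
Qed.
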